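(* Let $q$ be a prime power, let $P_1(t), \dots, P_r(t) \in \mathbb{F}_q[t]$ be distinct monic irreducible polynomials, and for each $1 \le j \le r$ let $H_j$ be a $P_j^{\infty}$-torsion $\mathbb{F}_q[t]$-module of finite length. Then $$\lim_{n \to \infty} \mathrm{Prob}_{A \in \mathrm{Mat}_n(\mathbb{F}_q)}\big(A[P_j^{\infty}] \simeq H_j \text{ for all } 1 \le j \le r\big) = \prod_{j=1}^{r} \frac{1}{|\mathrm{Aut}_{\mathbb{F}_q[t]}(H_j)|} \prod_{i=1}^{\infty} (1 - q^{-i \deg(P_j)}).$$
   Context: $\mathrm{Mat}_n(\mathbb{F}_q)$ is the set of $n \times n$ matrices over $\mathbb{F}_q$, and $\mathrm{Prob}_{A \in \mathrm{Mat}_n(\mathbb{F}_q)}$ is probability with respect to the uniform distribution on this finite set. For an $\mathbb{F}_q[t]$-module $M$ and a polynomial $P$, $M[P^{\infty}] := \{x \in M : P^N x = 0 \text{ for } N \gg 0\}$ (the $P$-part of $M$), and $M$ is called $P^{\infty}$-torsion if $M = M[P^{\infty}]$. For $A \in \mathrm{Mat}_n(\mathbb{F}_q)$, $A[P^{\infty}]$ denotes $M[P^{\infty}]$ where $M = \mathbb{F}_q^n$ is viewed as an $\mathbb{F}_q[t]$-module via $t \cdot v := Av$; isomorphisms $\simeq$ are of $\mathbb{F}_q[t]$-modules. *)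

(* Defs.v *)
From HB Require Import structures.
From mathcomp Require Import all_boot all_order all_algebra.
From mathcomp Require Import finmap.
From mathcomp Require Import all_classical all_reals all_analysis.

Set Implicit Arguments.
Unset Strict Implicit.
Unset Printing Implicit Defensive.

Import Order.TTheory GRing.Theory Num.Theory.
Import numFieldNormedType.Exports.

Local Open Scope ring_scope.

Section Modules.
Variable R : comNzRingType.

Definition torsion_pred (M : lmodType R) (P : R) : {pred M} :=
  [pred x : M |
     `[< exists N0 : nat, forall N : nat, (N0 <= N)%N -> P ^+ N *: x = 0 >]].
Arguments torsion_pred : clear implicits.

Lemma torsion_pred_closed (M : lmodType R) (P : R) :
  submod_closed (torsion_pred M P).
Proof.
split=> [|a u v]; first by apply/asboolP; exists 0%N => N _; rewrite scaler0.
move=> /asboolP[Nu hu] /asboolP[Nv hv]; apply/asboolP; exists (maxn Nu Nv) => N.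
rewrite geq_max => /andP[/hu PNu /hv PNv].
by rewrite scalerDr PNv addr0 scalerA mulrC -scalerA PNu scaler0.
Qed.

HB.instance Definition _ (M : lmodType R) (P : R) :=
  GRing.isSubmodClosed.Build R M (torsion_pred M P) (torsion_pred_closed M P).

Inductive torsion_part (M : lmodType R) (P : R) : predArgType :=
  TorsionPart (x : M) & x \in torsion_pred M P.

Definition torsion_val (M : lmodType R) (P : R) (u : torsion_part M P) : M :=
  let: TorsionPart x _ := u in x.

HB.instance Definition _ (M : lmodType R) (P : R) :=
  [isSub of torsion_part M P for @torsion_val M P].
HB.instance Definition _ (M : lmodType R) (P : R) :=
  [Choice of torsion_part M P by <:].
HB.instance Definition _ (M : lmodType R) (P : R) :=
  [SubChoice_isSubZmodule of torsion_part M P by <:].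
HB.instance Definition _ (M : lmodType R) (P : R) :=
  [SubZmodule_isSubLmodule of torsion_part M P by <:].

Definition is_torsion (M : lmodType R) (P : R) : Prop :=
  forall x : M, x \in torsion_pred M P.

Definition mod_iso (M N : lmodType R) : Prop :=
  exists f : {linear M -> N}, bijective f.

(* The lengths of the strict chains S 0 < S 1 < ... < S n of submodules of M
   are bounded; the values of S beyond n are irrelevant. *)
Definition finite_length (M : lmodType R) : Prop :=
  exists l : nat, forall (n : nat) (S : nat -> submodClosed M),
    (forall i : nat, (i < n)%N ->
       {subset S i <= S i.+1} /\ ~ {subset S i.+1 <= S i}) ->
    (n <= l)%N.

Definition mod_aut (M : lmodType R) : set (M -> M) :=
  [set f : M -> M | linear f /\ bijective f]%classic.
Arguments mod_aut : clear implicits.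

(* fset_set sends an infinite set to the empty one; the modules considered here
   (of finite length over F_q[t] and P^oo-torsion with P != 0) are finite. *)
Definition card_aut (M : lmodType R) : nat := #|` fset_set (mod_aut M)|%fset.

End Modules.

(* F^n with the F[t]-module structure t . v = A v.  The action is written as a
   sum of powers because horner_mx is only available for dimensions n.+1. *)
Definition mx_module (F : fieldType) (n : nat) (A : 'M[F]_n) : Type := 'cV[F]_n.

Section MatrixModule.
Variables (F : fieldType) (n : nat) (A : 'M[F]_n).

HB.instance Definition _ := GRing.Zmodule.copy (mx_module A) 'cV[F]_n.

Definition mx_scale (p : {poly F}) (v : mx_module A) : mx_module A :=
  (\sum_(i < size p) p`_i *: A ^+ i) *m v.

End MatrixModule.

Lemma mx_scaleE (F : fieldType) (n : nat) (A : 'M[F]_n.+1) p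
    (v : mx_module A) : mx_scale p v = horner_mx A p *m v.
Proof.
rewrite /mx_scale; congr (_ *m _).
rewrite [in RHS](_ : p = \sum_(i < size p) p`_i *: 'X^i); last first.
  by rewrite -poly_def coefK.
rewrite raddf_sum; apply: eq_bigr => i _ /=.
by rewrite linearZ /= rmorphXn /= horner_mx_X.
Qed.

Section MatrixModuleLaws.
Variables (F : fieldType) (n : nat) (A : 'M[F]_n).

Fact mx_scaleA (p q : {poly F}) (v : mx_module A) :
  mx_scale p (mx_scale q v) = mx_scale (p * q) v.
Proof.
case: n A v => [|m] B v; first by rewrite [LHS]flatmx0 [RHS]flatmx0.
by rewrite !mx_scaleE rmorphM /= mulmxA.
Qed.

Fact mx_scale1 : left_id 1 (@mx_scale F n A).
Proof.
case: n A => [|m] B v; first by rewrite [LHS]flatmx0 [RHS]flatmx0.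
by rewrite mx_scaleE rmorph1 mul1mx.
Qed.

Fact mx_scaleDr : right_distributive (@mx_scale F n A) +%R.
Proof. by move=> p u v; rewrite /mx_scale mulmxDr. Qed.

Fact mx_scaleDl (v : mx_module A) :
  {morph (@mx_scale F n A)^~ v : p q / p + q}.
Proof.
case: n A v => [|m] B v p q; first by rewrite [LHS]flatmx0 [RHS]flatmx0.
by rewrite !mx_scaleE rmorphD /= mulmxDl.
Qed.

HB.instance Definition _ := GRing.Zmodule_isLmodule.Build {poly F} (mx_module A)
  mx_scaleA mx_scale1 mx_scaleDr mx_scaleDl.

Lemma mx_module_scaleX (v : mx_module A) : 'X *: v = A *m v.
Proof.
rewrite [LHS]/GRing.scale /= /mx_scale size_polyX !big_ord_recl big_ord0 /=.
by rewrite !coefX /= scale0r add0r scale1r expr1 addr0.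
Qed.

End MatrixModuleLaws.

Definition mx_prob (R : realType) (F : finFieldType) (n : nat)
    (E : 'M[F]_n -> Prop) : R :=
  #|[set A : 'M[F]_n | `[< E A >]]%SET|%:R / #|{: 'M[F]_n}|%:R.

(* Main.v *)
(** Count pairs (A, f) with f : F_q^n -> T a surjection of modules and a
    condition on A that depends only on the kernel of f.  In a basis adapted to
    f the matrix A is block triangular, so the number of pairs is a product: the
    number of surjective linear maps, times the number of lower left blocks,
    times the number of (n - dim T)-square matrices with the condition.

    If T is P^oo-torsion and P has to act injectively on ker f, then the
    surjections from A form a torsor under Aut T when A[P^oo] ~ T, and there are
    none otherwise.  Hence prescribing A[P_j^oo] ~ H_j costs the factor
    1 / |Aut H_j|, up to a factor tending to 1, and replaces the condition at P_j
    by "P_j acts injectively".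

    For the latter condition let K = F_q[t]/(P) and Q = |K|.  With
    y = |Hom(A, K)|, the number of surjections A -> K^i is
    prod_(s < i) (y - Q^s), and the q-binomial theorem gives
    [P is injective on A] = sum_i (-1)^i #Sur(A, K^i) / prod_(l <= i) (Q^l - 1).
    Averaging over A and letting n tend to infinity (Tannery) leaves Euler's
    series for prod_(l >= 1) (1 - Q^-l). *)

Require Import Defs.
From HB Require Import structures.
From mathcomp Require Import all_boot all_order all_algebra.
From mathcomp Require Import finmap.
From mathcomp Require Import all_classical all_reals all_analysis.
From mathcomp Require Import ring lra zify.
Set Implicit Arguments.
Unset Strict Implicit.
Unset Printing Implicit Defensive.
Import Order.TTheory GRing.Theory Num.Theory.
Import numFieldNormedType.Exports.
Local Open Scope classical_set_scope.
Local Open Scope ring_scope.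

(** * Modules and exact sequences *)

Lemma inj_surj_bijective (S T : Type) (f : S -> T) :
  injective f -> (forall y, exists x, f x = y) -> bijective f.
Proof.
move=> inj_f /choice[g fgK]; exists g => // x.
by apply: inj_f; rewrite fgK.
Qed.

Lemma mod_isoP (R : comNzRingType) (M N : lmodType R) :
  mod_iso M N <-> exists2 f : M -> N, linear f & bijective f.
Proof.
split=> [[f bij_f]|[f lin_f bij_f]]; first by exists f => //; exact: linearP.
pose f' : {linear M -> N} := HB.pack f (GRing.isLinear.Build R M N *:%R f lin_f).
by exists f'.
Qed.

Lemma linear_inverse (R : comNzRingType) (M N : lmodType R) (f : M -> N)
    (g : N -> M) : linear f -> cancel f g -> cancel g f -> linear g.
Proof. by move=> lin_f fK gK a u v; apply: (can_inj fK); rewrite lin_f !gK. Qed.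

Lemma linear_comp (R : comNzRingType) (M N K : lmodType R) (f : M -> N)
    (g : N -> K) : linear f -> linear g -> linear (g \o f).
Proof. by move=> lin_f lin_g a u v; rewrite /= lin_f lin_g. Qed.

Lemma mod_iso_sym (R : comNzRingType) (M N : lmodType R) :
  mod_iso M N -> mod_iso N M.
Proof.
move=> /mod_isoP[f lin_f [g fK gK]]; apply/mod_isoP; exists g; last by exists f.
exact: linear_inverse lin_f fK gK.
Qed.

Lemma mod_iso_trans (R : comNzRingType) (M N K : lmodType R) :
  mod_iso M N -> mod_iso N K -> mod_iso M K.
Proof.
move=> /mod_isoP[f lin_f bij_f] /mod_isoP[g lin_g bij_g]; apply/mod_isoP.
by exists (g \o f); [exact: linear_comp | exact: bij_comp].
Qed.

Section LinearFunction.
Variables (R : comNzRingType) (M N : lmodType R) (f : M -> N) (lin_f : linear f).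

Let f' : {linear M -> N} := HB.pack f (GRing.isLinear.Build R M N *:%R f lin_f).

Lemma linear_map0 : f 0 = 0. Proof. exact: (raddf0 f'). Qed.
Lemma linear_mapB : {morph f : u v / u - v}. Proof. exact: (raddfB f'). Qed.
Lemma linear_mapD : {morph f : u v / u + v}. Proof. exact: (raddfD f'). Qed.
Lemma linear_mapZ a : {morph f : u / a *: u}. Proof. exact: (linearZ_LR f'). Qed.

Lemma linear_map_inj : (forall u, f u = 0 -> u = 0) -> injective f.
Proof.
move=> ker_f u v fuv; apply/eqP; rewrite -subr_eq0; apply/eqP/ker_f.
by rewrite linear_mapB fuv subrr.
Qed.

End LinearFunction.

(** Equivalent to the vanishing of the [D]-part, phrased without the subtype [torsion_part]. *)
Definition regular_on (R : comNzRingType) (M : lmodType R) (D : R) : Prop :=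
  forall v : M, D *: v = 0 -> v = 0.

Section Regular.
Variables (R : comNzRingType).
Implicit Types (K M N : lmodType R) (D : R).

Lemma regular_onX M D k : regular_on M D -> regular_on M (D ^+ k).
Proof.
move=> regD; elim: k => [|k IHk] v; first by rewrite expr0 scale1r.
by rewrite exprS -scalerA => /regD /IHk.
Qed.

Lemma torsion_predP M D (v : M) :
  reflect (exists k, D ^+ k *: v = 0) (v \in torsion_pred D).
Proof.
apply: (iffP (asboolP _)) => [[k kv]|[k kv]]; first by exists k; exact: kv.
exists k => l /subnK <-.
by rewrite exprD -scalerA kv scaler0.
Qed.

Lemma torsion_valZ M D a : {morph @torsion_val R M D : u / a *: u}.
Proof. exact: (linearZ_LR (\val : torsion_part M D -> M)). Qed.

Lemma torsion_valP M D : linear (@torsion_val R M D).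
Proof. exact: (linearP (\val : torsion_part M D -> M)). Qed.

Lemma torsion_val_inj M D : injective (@torsion_val R M D).
Proof. exact: val_inj. Qed.

Lemma torsion_part_is_torsion M D (u : torsion_part M D) :
  exists k, D ^+ k *: u = 0.
Proof.
case: u => x xD; have /torsion_predP[k kx] := xD; exists k.
by apply: torsion_val_inj; rewrite torsion_valZ (linear_map0 (@torsion_valP M D)).
Qed.

Section ShortExact.
Variables (K M N : lmodType R) (f : K -> M) (g : M -> N).
Hypotheses (lin_f : linear f) (lin_g : linear g) (inj_f : injective f).
Hypothesis (exact_fg : forall x, g x = 0 <-> exists y, f y = x).

(** A vector of [M] killed by [D] maps to a vector of [N] killed by [D], hence to 0, so it comes
    from [K]. The next lemma repeats this with powers of [D]. *)
Lemma regular_on_exact D :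
  regular_on N D -> regular_on M D <-> regular_on K D.
Proof.
move=> regN; split=> [regM v Dv|regK v Dv].
  apply: inj_f; rewrite linear_map0 //; apply: regM.
  by rewrite -linear_mapZ // Dv linear_map0.
have /exact_fg[w fw] : g v = 0.
  by apply: regN; rewrite -linear_mapZ // Dv linear_map0.
rewrite -fw (regK w) ?linear_map0 //.
by apply: inj_f; rewrite linear_mapZ // fw Dv linear_map0.
Qed.

Lemma torsion_part_exact D :
  regular_on N D -> mod_iso (torsion_part K D) (torsion_part M D).
Proof.
move=> regN; apply/mod_isoP.
have ftor (u : torsion_part K D) : f (torsion_val u) \in torsion_pred D.
  have [k ku] := torsion_part_is_torsion u; apply/torsion_predP; exists k.
  by rewrite -linear_mapZ // -torsion_valZ ku !linear_map0 //; exact: torsion_valP.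
exists (fun u => TorsionPart (ftor u)).
  by move=> a u v; apply: torsion_val_inj; rewrite [RHS]torsion_valP -lin_f -torsion_valP.
apply: inj_surj_bijective => [u v /(congr1 (@torsion_val _ _ _)) /= /inj_f|].
  exact: torsion_val_inj.
case=> x xD; have /torsion_predP[k kx] := xD.
have /exact_fg[w fw] : g x = 0.
  by apply: (regular_onX (k := k) regN); rewrite -linear_mapZ // kx linear_map0.
have wD : w \in torsion_pred D.
  apply/torsion_predP; exists k; apply: inj_f.
  by rewrite linear_mapZ // fw kx linear_map0.
by exists (TorsionPart wD); apply: torsion_val_inj.
Qed.

End ShortExact.

End Regular.

(** A Bezout relation between [P ^+ k] and [D] writes [v] as a sum of two zero terms. *)
Lemma coprime_torsion_regular (F : fieldType) (M : lmodType {poly F})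
    (P D : {poly F}) : is_torsion M P -> coprimep P D -> regular_on M D.
Proof.
move=> torM PD v Dv; have /torsion_predP[k kv] := torM v.
have /Bezout_eq1_coprimepP[[a b] /= ab1] : coprimep (P ^+ k) D by rewrite coprimep_expl.
by rewrite -(scale1r v) -ab1 scalerDl -!scalerA kv Dv !scaler0 addr0.
Qed.

Lemma monic_irreducible_coprime (F : fieldType) (P D : {poly F}) :
  P \is monic -> D \is monic -> irreducible_poly P -> irreducible_poly D ->
  P != D -> coprimep P D.
Proof.
move=> monP monD irrP irrD; rewrite irreducible_poly_coprime // -eqp_monic //.
by apply: contra; apply: irrD; rewrite gtn_eqF // irrP.
Qed.

(** * Modules defined by matrices *)

Lemma irreducible_poly_multiplicity (F : fieldType) (P m : {poly F}) :
  irreducible_poly P -> m != 0 ->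
  exists k, exists2 m' : {poly F}, m = P ^+ k * m' & coprimep P m'.
Proof.
move=> irrP; have [s] := ubnP (size m); elim: s m => // s IHs m.
rewrite ltnS => le_m m_neq0.
have [/dvdpP[q def_m]|] := boolP (P %| m); last first.
  by rewrite -irreducible_poly_coprime // => Pm; exists 0%N, m; rewrite // mul1r.
have q_neq0 : q != 0 by apply: contra_neq m_neq0 => q0; rewrite def_m q0 mul0r.
have lt_q : (size q < s)%N.
  apply: leq_trans le_m; rewrite def_m size_mul ?(irredp_neq0 irrP) //.
  by have := irrP.1; case: (size P) => [|[|l]] // _; rewrite !addnS /= ltnS leq_addr.
have [k [m' def_q Pm']] := IHs q lt_q q_neq0.
by exists k.+1, m' => //; rewrite def_m def_q exprSr mulrAC.
Qed.

(* x |-> x - u P^k x is the projection of M onto its P-part. *)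
Lemma primary_projection (F : fieldType) (M : lmodType {poly F})
    (P m : {poly F}) (k0 : nat) :
  irreducible_poly P -> m != 0 -> (forall x : M, m *: x = 0) ->
  exists2 k, (k0 <= k)%N &
    exists u : {poly F}, forall x : M, P ^+ k *: (x - (u * P ^+ k) *: x) = 0.
Proof.
move=> irrP m_neq0 mM; have [k [m' def_m Pm']] := irreducible_poly_multiplicity irrP m_neq0.
exists (maxn k0 k); first exact: leq_maxl.
have /Bezout_eq1_coprimepP[[u w] /= uw1] : coprimep (P ^+ maxn k0 k) m'.
  by rewrite coprimep_expl.
(* By Bezout the difference is [(w * m') *: x], and the exponent [maxn k0 k] makes its product with
   the power of [P] a multiple of [m]. *)
exists u => x; rewrite -[X in X - _]scale1r -uw1 -scalerBl addrAC subrr add0r.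
rewrite scalerA -(subnK (leq_maxr k0 k)) exprD.
have -> (a b : {poly F}) : a * P ^+ k * (b * m') = a * b * m by rewrite def_m; ring.
by rewrite -scalerA mM scaler0.
Qed.

Section MatrixModules.
Variable F : fieldType.

Lemma mx_module_scaleE n (A : 'M[F]_n) (p : {poly F}) (v : mx_module A) :
  p *: v = (\sum_(i < size p) p`_i *: A ^+ i) *m v.
Proof. by []. Qed.

Lemma intertwine_expr n h (A : 'M[F]_n) (T : 'M[F]_h) (f : 'M[F]_(h, n)) i :
  f *m A = T *m f -> f *m (A ^+ i) = T ^+ i *m f.
Proof.
move=> fA; elim: i => [|i IHi]; first by rewrite !expr0 mulmx1 mul1mx.
by rewrite exprS mulmxA fA -mulmxA IHi exprS mulmxA.
Qed.

Lemma intertwine_sum n h (A : 'M[F]_n) (T : 'M[F]_h) (f : 'M[F]_(h, n)) s (c : nat -> F) :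
  f *m A = T *m f ->
  f *m (\sum_(i < s) c i *: A ^+ i) = (\sum_(i < s) c i *: T ^+ i) *m f.
Proof.
move=> fA; rewrite mulmx_sumr mulmx_suml; apply: eq_bigr => i _.
by rewrite -scalemxAr -scalemxAl (intertwine_expr _ fA).
Qed.

Lemma intertwine_linear n h (A : 'M[F]_n) (T : 'M[F]_h) (f : 'M[F]_(h, n)) :
  f *m A = T *m f -> linear (fun v : mx_module A => f *m v : mx_module T).
Proof.
move=> fA a u v; rewrite [LHS]mulmxDr; congr (_ + _).
by rewrite !mx_module_scaleE !mulmxA (intertwine_sum _ _ fA).
Qed.

Lemma mx_module_scaleC n (A : 'M[F]_n) c (v : mx_module A) :
  c%:P *: v = (c *: (v : 'cV[F]_n) : 'cV[F]_n).
Proof.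
rewrite mx_module_scaleE size_polyC; have [->|c0] := eqVneq.
  by rewrite big_ord0 mul0mx scale0r.
by rewrite big_ord_recl big_ord0 addr0 coefC expr0 -scalemxAl mul1mx.
Qed.

Lemma mulmx_cV_inj m n (A B : 'M[F]_(m, n)) :
  (forall v : 'cV[F]_n, A *m v = B *m v) -> A = B.
Proof.
move=> AB; apply/matrixP => i j.
by have := congr1 (fun w : 'cV[F]_m => w i 0) (AB (delta_mx j 0)); rewrite -!colE !mxE.
Qed.

Lemma linear_cV_mulmx n h (g : 'cV[F]_n -> 'cV[F]_h) :
  linear g -> exists f : 'M[F]_(h, n), forall v, g v = f *m v.
Proof.
move=> lin_g; exists (\matrix_(i, j) g (delta_mx j 0) i 0) => v.
rewrite {1}(matrix_sum_delta v) (big_morph _ (linear_mapD lin_g) (linear_map0 lin_g)).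
apply/colP=> i; rewrite !mxE summxE; apply: eq_bigr => j _.
by rewrite big_ord1 (linear_mapZ lin_g) !mxE mulrC.
Qed.

(** Constants make [g] linear over [F], hence a matrix, and ['X] gives the intertwining relation.
    Module maps can thus be counted as matrices. *)
Lemma linear_intertwine n h (A : 'M[F]_n) (T : 'M[F]_h)
    (g : mx_module A -> mx_module T) :
  linear g -> exists2 f : 'M[F]_(h, n), f *m A = T *m f & forall v, g v = f *m v.
Proof.
move=> lin_g; have /linear_cV_mulmx[f gE] : linear (g : 'cV[F]_n -> 'cV[F]_h).
  by move=> a u v; have := lin_g a%:P u v; rewrite !mx_module_scaleC.
exists f => //; apply: mulmx_cV_inj => v; rewrite -!mulmxA.
by rewrite -(mx_module_scaleX (v : mx_module A)) -!gE linear_mapZ // mx_module_scaleX.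
Qed.

Lemma poly_linear (M N : lmodType {poly F}) (g : M -> N) :
  {morph g : u v / u + v} -> (forall c u, g (c%:P *: u) = c%:P *: g u) ->
  (forall u, g ('X *: u) = 'X *: g u) -> linear g.
Proof.
move=> gD gC gX p u v; rewrite gD; congr (_ + _).
elim/poly_ind: p u => [|p c IHp] u; first by rewrite -polyC0 gC.
by rewrite !scalerDl gD gC -!scalerA IHp gX.
Qed.

End MatrixModules.

(** * Surjections onto a primary module *)

Section PrimarySurjections.
Variables (F : fieldType) (n h : nat) (A : 'M[F]_n) (T : 'M[F]_h) (P : {poly F}).

Lemma mx_module_annihilated :
  exists2 m : {poly F}, m != 0 & forall v : mx_module A, m *: v = 0.
Proof.
case: n A => [|n'] B; first exists 1 => [|v].
- exact: oner_neq0.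
- by rewrite [LHS]flatmx0 [RHS]flatmx0.
exists (char_poly B); first by rewrite monic_neq0 ?char_poly_monic.
by move=> v; rewrite [LHS]mx_scaleE Cayley_Hamilton mul0mx.
Qed.

(** Preimages of the basis vectors are the columns of a right inverse. Surjectivity of
    [v |-> f *m v] is expressed by [row_free f] from here on. *)
Lemma row_free_surj (f : 'M[F]_(h, n)) :
  (forall y : 'cV[F]_h, exists x, f *m x = y) -> row_free f.
Proof.
move=> /choice[g fg]; apply/row_freeP.
exists (\matrix_(i, j) g (delta_mx j 0) i 0); apply/matrixP => i j.
have /(congr1 (fun w : 'cV[F]_h => w i 0)) := fg (delta_mx j 0).
by rewrite !mxE andbT => <-; apply: eq_bigr => k _; rewrite !mxE.
Qed.

(** The kernel is not formed as a module here; [regular_ker_kernel] translates the condition to a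
    matrix of the action on the kernel. *)
Definition regular_ker (f : 'M[F]_(h, n)) : Prop :=
  forall v : mx_module A, f *m v = 0 -> P *: v = 0 -> v = 0.

End PrimarySurjections.

(** Write an annihilator as [P ^+ k * m'] with [m'] prime to [P]. Since [m'] acts injectively on a
    [P]-power torsion module, [P ^+ k] already annihilates. *)
Lemma mx_module_bounded_torsion (F : fieldType) h (T : 'M[F]_h) (P : {poly F}) :
  irreducible_poly P -> is_torsion (mx_module T) P ->
  exists k, forall v : mx_module T, P ^+ k *: v = 0.
Proof.
move=> irrP torT; have [m m_neq0 mT] := mx_module_annihilated T.
have [k [m' def_m Pm']] := irreducible_poly_multiplicity irrP m_neq0.
exists k => v; apply: (coprime_torsion_regular torT Pm').
by rewrite scalerA mulrC -def_m mT.
Qed.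

Section PrimarySurjectionsCount.
Variables (F : finFieldType) (n h : nat) (A : 'M[F]_n) (T : 'M[F]_h) (P : {poly F}).
Hypotheses (irrP : irreducible_poly P) (torT : is_torsion (mx_module T) P).

Lemma regular_kerX (f : 'M[F]_(h, n)) k (v : mx_module A) :
  f *m A = T *m f -> regular_ker A P f ->
  f *m v = 0 -> P ^+ k *: v = 0 -> v = 0.
Proof.
move=> fA regf fv; elim: k => [|k IHk]; first by rewrite expr0 scale1r.
rewrite exprS -scalerA => Pkv; apply: IHk; apply: regf => //.
by rewrite (linear_mapZ (intertwine_linear fA)) fv scaler0.
Qed.

(** One exponent serves both modules. Any module map into [T] takes the same value at [x] and at its
    projection, which reduces everything to the [P]-part of [A]. *)
Lemma torsion_part_projection : exists k u,
  (forall v : mx_module T, P ^+ k *: v = 0) /\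
  (forall x : mx_module A, P ^+ k *: (x - (u * P ^+ k) *: x) = 0).
Proof.
have [k0 k0T] := mx_module_bounded_torsion irrP torT.
have [m m_neq0 mA] := mx_module_annihilated A.
have [k k0k [u ku]] := primary_projection k0 irrP m_neq0 mA.
exists k, u; split=> // v.
by rewrite -(subnK k0k) exprD -scalerA k0T scaler0.
Qed.

(** The restriction of [f] to the [P]-part is injective because [P] is injective on the kernel, and
    surjective because a preimage may be replaced by its projection. *)
Lemma regular_surjection_iso (f : 'M[F]_(h, n)) :
  f *m A = T *m f -> row_free f -> regular_ker A P f ->
  mod_iso (torsion_part (mx_module A) P) (mx_module T).
Proof.
move=> fA /row_freeP[B fB] regf; have lin_f := intertwine_linear fA.
have [k [u [kT ku]]] := torsion_part_projection.
apply/mod_isoP; pose phi (w : torsion_part (mx_module A) P) : mx_module T := f *m torsion_val w.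
have lin_phi : linear phi by apply: (linear_comp (@torsion_valP _ _ _) lin_f).
exists phi => //.
apply: inj_surj_bijective => [|y].
  apply: linear_map_inj => // w fw.
  have [j jw] := torsion_part_is_torsion w; apply: torsion_val_inj.
  rewrite [RHS](linear_map0 (@torsion_valP _ _ _)).
  apply: (regular_kerX fA regf fw (k := j)).
  by rewrite -torsion_valZ jw (linear_map0 (@torsion_valP _ _ _)).
have xP : (B *m y : mx_module A) - (u * P ^+ k) *: (B *m y : mx_module A)
            \in torsion_pred P.
  by apply/torsion_predP; exists k.
exists (TorsionPart xP); rewrite /phi /= (linear_mapB lin_f) (linear_mapZ lin_f).
by rewrite -[u * _ *: _]scalerA kT scaler0 subr0 mulmxA fB mul1mx.
Qed.

(** Compose the isomorphism [g] with the projection onto the [P]-part; the kernel of the result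
    meets the [P]-part only in 0. *)
Lemma iso_regular_surjection :
  mod_iso (torsion_part (mx_module A) P) (mx_module T) ->
  exists f : 'M[F]_(h, n), [/\ f *m A = T *m f, row_free f & regular_ker A P f].
Proof.
move=> /mod_isoP[g lin_g [g' gK g'K]].
have [k [u [kT ku]]] := torsion_part_projection.
have eP (x : mx_module A) : x - (u * P ^+ k) *: x \in torsion_pred P.
  by apply/torsion_predP; exists k.
have lin_e : linear (fun x => TorsionPart (eP x)).
  move=> a x y; apply: torsion_val_inj; rewrite [RHS]torsion_valP /=.
  by rewrite scalerDr opprD addrACA scalerBr !scalerA (mulrC _ a).
(* The projection is the identity on the [P]-part: [P ^+ k] kills that part because [g] embeds it
   into [T]. *)
have eK (w : torsion_part (mx_module A) P) : TorsionPart (eP (torsion_val w)) = w.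
  have kw : P ^+ k *: w = 0.
    by apply: (can_inj gK); rewrite linear_mapZ // kT linear_map0.
  apply: torsion_val_inj => /=.
  by rewrite -scalerA -torsion_valZ kw (linear_map0 (@torsion_valP _ _ _)) scaler0 subr0.
have [f fA fE] := linear_intertwine (linear_comp lin_e lin_g).
exists f; split=> // [|v fv Pv].
  apply: row_free_surj => y; exists (torsion_val (g' y)).
  by rewrite -fE /= eK g'K.
have vP : v \in torsion_pred P by apply/torsion_predP; exists 1%N.
have := fE v; rewrite fv /= (eK (TorsionPart vP)) => gv0.
have /(congr1 (@torsion_val _ _ _)) : TorsionPart vP = 0.
  by apply: (can_inj gK); rewrite gv0 linear_map0.
by rewrite (linear_map0 (@torsion_valP _ _ _)).
Qed.

(** With one surjection [f0] fixed, the others are exactly the [a *m f0] with [a] an automorphism of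
    [T]. *)
Lemma card_regular_surjections :
  #|[pred f : 'M[F]_(h, n) |
      [&& f *m A == T *m f, row_free f & `[< regular_ker A P f >]]]| =
  (`[< mod_iso (torsion_part (mx_module A) P) (mx_module T) >] *
   #|[pred a : 'M[F]_h | (a *m T == T *m a) && row_free a]|)%N.
Proof.
case: asboolP => [/iso_regular_surjection[f0 [f0A free_f0 reg_f0]]|niso]; last first.
  rewrite mul0n; apply: eq_card0 => f; rewrite !inE; apply/negP.
  case/and3P=> /eqP fA free_f /asboolP regf.
  exact/niso/(regular_surjection_iso fA).
have [k [u [kT ku]]] := torsion_part_projection.
rewrite mul1n -(fintype.card_image (row_free_inj free_f0)); apply: eq_card => f.
rewrite inE; apply/idP/fintype.imageP => [/and3P[/eqP fA free_f /asboolP regf]|[a]].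
  (* For [x] in the kernel of [f0], the projection [e] lies there too and is killed by [P ^+ k], so
     [e = 0]; and [f] agrees on [x] and [e]. Hence [f] factors through [f0]. *)
  have ker_f (x : 'cV[F]_n) : f0 *m x = 0 -> f *m x = 0.
    move=> f0x; set e := (x : mx_module A) - (u * P ^+ k) *: (x : mx_module A).
    suff e0 : e = 0.
      have := linear_map0 (intertwine_linear fA); rewrite -e0.
      rewrite (linear_mapB (intertwine_linear fA)) (linear_mapZ (intertwine_linear fA)).
      by rewrite -[_ *: (f *m x : mx_module T)]scalerA kT scaler0 subr0.
    apply: (regular_kerX f0A reg_f0 _ (ku x)).
    rewrite (linear_mapB (intertwine_linear f0A)) (linear_mapZ (intertwine_linear f0A)).
    by rewrite f0x scaler0 subr0.
  have f_f0 : (f <= f0)%MS.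
    rewrite submxE; apply/eqP/mulmx_cV_inj => v; rewrite mul0mx -mulmxA ker_f //.
    by rewrite mulmxA mulmx_coker mul0mx.
  have [a fE] := submxP f_f0; exists a => //.
  rewrite inE; apply/andP; split; last first.
    rewrite /row_free eqn_leq rank_leq_row /=.
    by have := mxrankM_maxl a f0; rewrite -fE (eqP free_f).
  apply/eqP/(row_free_inj free_f0).
  by rewrite -mulmxA -f0A mulmxA -fE fA fE mulmxA.
rewrite inE => /andP[/eqP aT free_a] ->; apply/and3P; split.
- by rewrite -mulmxA f0A !mulmxA aT.
- by rewrite /row_free mxrankMfree.
apply/asboolP => v; rewrite -mulmxA => af0v; apply: reg_f0.
have /row_freeP[b ab1] := free_a.
rewrite -[LHS]mul1mx -(mulmx1C ab1) -mulmxA.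
have -> : a *m (f0 *m v) = 0 by rewrite -af0v.
by rewrite mulmx0.
Qed.

End PrimarySurjectionsCount.

(** * Counting surjections *)

Lemma card_rV (F : finFieldType) n : #|{: 'rV[F]_n}| = (#|F| ^ n)%N.
Proof. by rewrite card_mx mul1n. Qed.

(** From [f = L [1 0] R] with [L] and [R] invertible, take [g = diag(L, 1) R]. *)
Lemma row_free_complete (F : fieldType) h m (f : 'M[F]_(h, h + m)) :
  row_free f -> exists2 g : 'M[F]_(h + m), g \in unitmx & usubmx g = f.
Proof.
move=> free_f; exists (block_mx (col_ebase f) 0 0 1%:M *m row_ebase f).
  by rewrite unitmx_mul row_ebase_unit unitmxE det_ublock det1 mulr1 -unitmxE col_ebase_unit.
rewrite -mul_usub_mx /block_mx col_mxKu.
rewrite -[RHS]mulmx_ebase; congr (_ *m _).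
by rewrite (eqP free_f) pid_mx_row mul_mx_row mulmx1 mulmx0.
Qed.

(** The columns of [k] form a basis of the kernel; a [B] with [A *m k = k *m B] is then the matrix
    of [A] on it. *)
Definition is_kernel (F : fieldType) h n m (f : 'M[F]_(h, n)) (k : 'M[F]_(n, m)) :=
  injective (mulmx k : 'cV[F]_m -> 'cV[F]_n) /\
  forall v : 'cV[F]_n, f *m v = 0 <-> exists w : 'cV[F]_m, k *m w = v.

(** In the basis given by [g], the relation [f *m A = T *m f] makes [A] block lower triangular with
    diagonal blocks [T] and [B]. The lower left block is arbitrary, and [B] is the action on the
    kernel, subject to [Q]. *)
Lemma card_extensions (F : finFieldType) h m (T : 'M[F]_h) (f : 'M[F]_(h, h + m))
    (E : pred 'M[F]_(h + m)) (Q : pred 'M[F]_m) :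
  row_free f ->
  (forall A B (k : 'M[F]_(h + m, m)),
    f *m A = T *m f -> A *m k = k *m B -> is_kernel f k -> E A = Q B) ->
  #|[pred A | (f *m A == T *m f) && E A]| = (#|F| ^ (h * m) * #|Q|)%N.
Proof.
move=> /row_free_complete[g g_unit fE] EQ.
pose X (p : 'M[F]_(m, h) * 'M[F]_m) := invmx g *m block_mx T 0 p.1 p.2 *m g.
pose k := rsubmx (invmx g).
have gk : g *m k = col_mx 0 1%:M.
  rewrite /k mulmx_rsub mulmxV //.
  by rewrite scalar_mx_block block_mxEh row_mxKr.
have fg : f *m invmx g = row_mx 1%:M 0.
  rewrite -fE mul_usub_mx mulmxV //.
  by rewrite scalar_mx_block col_mxKu.
have fk : f *m k = 0.
  by rewrite -[k](mulKmx g_unit) gk mulmxA fg mul_row_col mulmx0 mul0mx addr0.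
have kerk : is_kernel f k.
  split=> [u v /(congr1 (mulmx g))|v].
    by rewrite !mulmxA gk !mul_col_mx !mul1mx !mul0mx => /eq_col_mx[].
  split=> [fv|[w <-]]; last by rewrite mulmxA fk mul0mx.
  exists (dsubmx (g *m v)); apply: (can_inj (mulKmx g_unit)).
  rewrite mulmxA gk mul_col_mx mul0mx mul1mx -[RHS]vsubmxK; congr col_mx.
  by rewrite -mul_usub_mx fE fv.
have fX p : f *m X p = T *m f.
  rewrite /X !mulmxA fg mul_row_block !mul1mx !mul0mx !addr0.
  by rewrite -[in LHS](vsubmxK g) mul_row_col mul0mx addr0 fE.
have Xk p : X p *m k = k *m p.2.
  rewrite /X -mulmxA gk -mulmxA mul_block_col !mulmx0 !add0r.
  by rewrite -[invmx g in LHS]hsubmxK mul_row_col !mulmx1 mulmx0 add0r.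
have injX : injective X.
  move=> [C B] [C' B'] /(congr1 (fun Y => g *m Y *m invmx g)).
  by rewrite /X /= !mulmxA mulmxV // !mul1mx !mulmxK // => /eq_block_mx[_ _ -> ->].
have -> : (#|F| ^ (h * m) * #|Q|)%N = #|[predX {: 'M[F]_(m, h)} & Q]|.
  by rewrite cardX card_mx (mulnC m h).
rewrite -(fintype.card_image injX); apply: eq_card => A; rewrite inE.
apply/idP/fintype.imageP => [/andP[/eqP fA EA]|[[C B]]]; last first.
  rewrite !inE /= => QB ->; apply/andP; split; first by rewrite fX.
  by rewrite (EQ _ _ _ (fX _) (Xk _) kerk).
pose Y := g *m A *m invmx g.
(* As [f] is the upper part of [g], the relation [f *m A = T *m f] determines the upper rows of
   [Y]. *)
have YE : Y = block_mx T 0 (dlsubmx Y) (drsubmx Y).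
  rewrite -[Y in LHS]submxK; congr block_mx.
    rewrite /ulsubmx /Y -mulmxA -mul_usub_mx fE mulmxA fA -mulmxA fg.
    by rewrite mul_mx_row row_mxKl mulmx1.
  rewrite /ursubmx /Y -mulmxA -mul_usub_mx fE mulmxA fA -mulmxA fg.
  by rewrite mul_mx_row row_mxKr mulmx0.
have AE : A = X (dlsubmx Y, drsubmx Y).
  by rewrite /X /= -YE /Y !mulmxA mulVmx // mul1mx mulmxKV.
exists (dlsubmx Y, drsubmx Y) => //; rewrite inE /=.
by have := EQ _ _ _ (fX (dlsubmx Y, drsubmx Y)) (Xk _) kerk; rewrite -AE EA.
Qed.

Lemma card_dependent_pairs (I J : finType) (Q : pred I) (S : I -> pred J) c :
  (forall i, Q i -> #|S i| = c) ->
  #|[pred p : I * J | Q p.1 && S p.1 p.2]| = (#|Q| * c)%N.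
Proof.
move=> Sc; transitivity (\sum_(i | Q i) \sum_(j | S i j) 1)%N.
  by rewrite pair_big_dep /= -sum1_card; apply: eq_bigl.
rewrite (eq_bigr (fun=> c)) => [|i Qi]; last by rewrite sum1_card Sc.
by rewrite sum_nat_const.
Qed.

Lemma row_free_col_mx (F : fieldType) d h n (g : 'M[F]_(d, n)) (f : 'M[F]_(h, n)) :
  reflect (row_free f /\ forall w : 'rV[F]_d, (w *m g <= f)%MS -> w = 0)
          (row_free (col_mx g f)).
Proof.
apply: (iffP idP) => [free_gf|[free_f gf]].
  have kergf (u : 'rV[F]_d) (v : 'rV[F]_h) :
    u *m g + v *m f = 0 -> row_mx u v = 0.
    by rewrite -mul_row_col => uv; apply: (row_free_inj free_gf); rewrite uv mul0mx.
  split=> [|w /submxP[v wv]].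
    apply: inj_row_free => v vf; have := kergf 0 v.
    by rewrite mul0mx add0r => /(_ vf) /eqP; rewrite row_mx_eq0 eqxx => /eqP.
  have := kergf w (- v); rewrite mulNmx -wv subrr => /(_ erefl) /eqP.
  by rewrite row_mx_eq0 => /andP[/eqP].
apply: inj_row_free => uv; rewrite -[uv]hsubmxK mul_row_col => /eqP.
rewrite addr_eq0 => /eqP ugf.
have u0 : lsubmx uv = 0 by apply: gf; rewrite ugf -mulNmx submxMl.
move: ugf; rewrite u0 mul0mx => /esym/eqP; rewrite oppr_eq0 => /eqP vf0.
have -> : rsubmx uv = 0 by apply: (row_free_inj free_f); rewrite vf0 mul0mx.
by rewrite row_mx0.
Qed.

Lemma card_submx (F : finFieldType) h n (f : 'M[F]_(h, n)) :
  row_free f -> #|[pred u : 'rV[F]_n | (u <= f)%MS]| = (#|F| ^ h)%N.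
Proof.
move=> free_f; rewrite -card_rV.
rewrite -(fintype.card_image (row_free_inj (m := 1) free_f)); apply: eq_card => u.
rewrite inE; apply/submxP/fintype.imageP => [[v ->]|[v _ ->]]; by exists v.
Qed.

Lemma card_row_free (F : finFieldType) h n :
  #|[pred f : 'M[F]_(h, n) | row_free f]| = (\prod_(i < h) (#|F| ^ n - #|F| ^ i))%N.
Proof.
elim: h => [|h IHh].
  rewrite big_ord0 (eq_card (B := predT)) ?card_mx ?mul0n // => f.
  by rewrite !inE /row_free flatmx0 mxrank0.
rewrite big_ord_recr /= -IHh.
rewrite -(card_dependent_pairs (S := fun f (u : 'rV[F]_n) => ~~ (u <= f)%MS)); last first.
  move=> f free_f; rewrite -(card_submx free_f) -card_rV.
  by rewrite -(cardC [pred u : 'rV[F]_n | (u <= f)%MS]) addKn.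
pose X (p : 'M[F]_(h, n) * 'rV[F]_n) : 'M[F]_(h.+1, n) := col_mx p.2 p.1.
have injX : injective X by move=> [f u] [g v] /= /(@eq_col_mx F 1 h n u f v g)[-> ->].
rewrite -(fintype.card_image injX); apply: eq_card => f; rewrite inE.
have XE (u : 'rV[F]_n) (g : 'M[F]_(h, n)) : row_free (col_mx u g) = row_free g && ~~ (u <= g)%MS.
  apply/row_free_col_mx/andP => -[free_g ug]; split=> //.
    apply/negP => le_ug; have := ug 1%:M; rewrite mul1mx => /(_ le_ug)/matrixP/(_ 0 0).
    by rewrite !mxE => /eqP; rewrite oner_eq0.
  move=> w; rewrite [w]mx11_scalar mul_scalar_mx => le_wug.
  suff -> : w 0 0 = 0 by rewrite raddf0.
  by apply: contraNeq ug => w0; rewrite -(eqmx_scale _ w0).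
apply/idP/fintype.imageP => [free_f|[[g u]]]; last first.
  by rewrite inE /= -XE => free_gu ->.
exists (dsubmx (f : 'M[F]_(1 + h, n)), usubmx (f : 'M[F]_(1 + h, n))).
  by rewrite inE /= -XE vsubmxK.
by rewrite /X /= vsubmxK.
Qed.

(** Sum over the surjections first; [card_extensions] then counts the matrices for each of them.
    With [n = h + m] as a hypothesis, the result applies to [m = n - h]. *)
Lemma card_surjection_pairs (F : finFieldType) h m n (T : 'M[F]_h)
    (E : 'M[F]_n -> pred 'M[F]_(h, n)) (Q : pred 'M[F]_m) :
  n = (h + m)%N ->
  (forall A B (f : 'M[F]_(h, n)) (k : 'M[F]_(n, m)),
    f *m A = T *m f -> A *m k = k *m B -> is_kernel f k -> E A f = Q B) ->
  (\sum_(A : 'M[F]_n) #|[pred f | [&& f *m A == T *m f, row_free f & E A f]]| =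
   #|[pred f : 'M[F]_(h, n) | row_free f]| * (#|F| ^ (h * m) * #|Q|))%N.
Proof.
move=> def_n; move: E; rewrite {n}def_n => E EQ.
rewrite -(card_dependent_pairs
            (S := fun f => [pred A | (f *m A == T *m f) && E A f])) => [|f free_f].
  transitivity (\sum_(A : 'M[F]_(h + m)) \sum_(f | [&& f *m A == T *m f, row_free f & E A f]) 1)%N.
    by apply: eq_bigr => A _; rewrite sum1_card.
  rewrite (exchange_big_dep (@row_free F h (h + m))) => [|A f _ /and3P[]//].
  rewrite pair_big_dep /= -sum1_card; apply: eq_bigl => -[f A] /=.
  by rewrite !inE /=; case: row_free; rewrite ?andbF.
by apply: card_extensions => // A B k; apply: EQ.
Qed.

(** * Densities of sets of matrices *)

Section Density.
Variables (R : realType) (F : finFieldType).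

Definition mx_density n (Q : pred 'M[F]_n) : R := #|Q|%:R / #|{: 'M[F]_n}|%:R.

(** For [q = #|F|] this is the proportion of surjective maps among the [h] by [n] matrices. It is 0
    for [n < h] because of the factor [i = n]. *)
Definition surj_density (q : R) n h : R := \prod_(i < h) (1 - q ^+ i / q ^+ n).

Lemma surj_density_small (q : R) n h : q != 0 -> (n < h)%N -> surj_density q n h = 0.
Proof.
move=> q0 lt_nh; rewrite /surj_density (bigD1 (Ordinal lt_nh)) //=.
by rewrite divff ?expf_neq0 // subrr mul0r.
Qed.

Lemma density_surjection_pairs h n (T : 'M[F]_h)
    (E : 'M[F]_n -> pred 'M[F]_(h, n)) (Q : pred 'M[F]_(n - h)) :
  (forall A B (f : 'M[F]_(h, n)) (k : 'M[F]_(n, n - h)),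
    f *m A = T *m f -> A *m k = k *m B -> is_kernel f k -> E A f = Q B) ->
  (\sum_(A : 'M[F]_n) #|[pred f | [&& f *m A == T *m f, row_free f & E A f]]|)%:R
     / #|{: 'M[F]_n}|%:R =
  surj_density #|F|%:R n h * mx_density Q.
Proof.
move=> EQ.
have q0 : (#|F|%:R : R) != 0 by rewrite pnatr_eq0 -lt0n; apply: ltnW (card_finNzRing_gt1 F).
(* For [n < h] there are no surjections and [surj_density] is 0, so the truncated [n - h] does no
   harm. *)
have [le_hn|lt_nh] := leqP h n; last first.
  rewrite surj_density_small // mul0r big1 ?mul0r // => A _.
  apply: eq_card0 => f; rewrite !inE; apply/negP => /and3P[_ /eqP rf _].
  by have := rank_leq_col f; rewrite rf leqNgt lt_nh.
rewrite (card_surjection_pairs (esym (subnKC le_hn)) EQ) card_row_free.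
rewrite /mx_density !card_mx !natrM !natrX natr_prod /surj_density.
have -> : \prod_(i < h) (#|F| ^ n - #|F| ^ i)%:R =
          (#|F|%:R ^+ n) ^+ h * \prod_(i < h) (1 - #|F|%:R ^+ i / #|F|%:R ^+ n) :> R.
  rewrite -[X in _ ^+ X]card_ord -prodr_const -big_split /=; apply: eq_bigr => i _.
  rewrite natrB ?leq_pexp2l ?(ltnW (card_finNzRing_gt1 F)) ?(leq_trans (ltnW (ltn_ord i))) //.
  by rewrite !natrX mulrBr mulr1 mulrCA divff ?expf_neq0 // mulr1.
set c := \prod_(i < h) _.
rewrite -exprM.
have -> : (#|F|%:R : R) ^+ (n * n) =
    #|F|%:R ^+ (n * h) * #|F|%:R ^+ (h * (n - h)) * #|F|%:R ^+ ((n - h) * (n - h)).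
  by rewrite -!exprD; congr (_ ^+ _); nia.
by field; rewrite !expf_neq0.
Qed.

End Density.

(** * Automorphism groups *)

Section CardAut.
Local Open Scope fset_scope.

(** Conjugation by [f] turns automorphisms of [H] into invertible matrices commuting with [T]. So
    they form a finite set, and the default value of [fset_set] does not occur. *)
Lemma card_autE (F : finFieldType) h (T : 'M[F]_h) (H : lmodType {poly F}) :
  mod_iso (mx_module T) H ->
  card_aut H = #|[pred a : 'M[F]_h | (a *m T == T *m a) && row_free a]|.
Proof.
move=> /mod_isoP[f lin_f [g fK gK]].
have lin_g := linear_inverse lin_f fK gK.
set S := [pred a : 'M[F]_h | _].
pose X (a : 'M[F]_h) : H -> H := fun x => f (a *m g x : mx_module T).
have injX : injective X.
  move=> a b Xab; apply: mulmx_cV_inj => v; apply: (can_inj fK).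
  by have := congr1 (@^~ (f v)) Xab; rewrite /X fK.
have -> : card_aut H = #|` [fset X a | a in S]|.
  rewrite /card_aut -[[fset X a | a in S]]set_fsetK; congr (#|` fset_set _|).
  apply/seteqP; split=> [y [lin_y bij_y]|y /= /imfsetP[a]].
    have lin_gyf : linear (g \o y \o f) by do 2!apply: linear_comp => //.
    have [a aT aE] := linear_intertwine lin_gyf.
    apply/imfsetP; exists a; last by apply/funext => x; rewrite /X -aE /= !gK.
    rewrite !inE aT eqxx /=; apply: row_free_surj => v.
    have [y' yK y'K] := bij_y; exists (g (y' (f v))).
    by rewrite -aE /= gK y'K fK.
  rewrite !inE => /andP[/eqP aT free_a] ->; split.
    exact: (linear_comp lin_g (linear_comp (intertwine_linear aT) lin_f)).
  have [b ab1] := row_freeP free_a; exists (fun x => f (b *m g x : mx_module T)) => x.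
    by rewrite /X fK mulmxA (mulmx1C ab1) mul1mx gK.
  by rewrite /X fK mulmxA ab1 mul1mx gK.
rewrite card_imfset //.
by rewrite cardE; apply/perm_size/uniq_perm => [||a]; rewrite ?enum_uniq ?enum_finmem_uniq //.
Qed.

End CardAut.

(** * Surjections onto powers of a simple module *)

Lemma horner_mx_sum (F : fieldType) n (A : 'M[F]_n.+1) (p : {poly F}) :
  horner_mx A p = \sum_(i < size p) p`_i *: A ^+ i.
Proof.
rewrite [in LHS](_ : p = \sum_(i < size p) p`_i *: 'X^i); last by rewrite -poly_def coefK.
rewrite raddf_sum; apply: eq_bigr => i _ /=.
by rewrite linearZ /= rmorphXn /= horner_mx_X.
Qed.

Section CompanionPowers.
Variables (F : finFieldType) (P : {poly F}).
Hypotheses (irrP : irreducible_poly P) (monP : P \is monic).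

(* The companion matrix of P, with its size in successor form so that horner_mx
   applies. *)
Lemma companion_exists : exists d, exists C : 'M[F]_d.+1,
  [/\ size P = d.+2, horner_mx C P = 0 &
      forall i : 'I_d.+1, delta_mx 0 0 *m C ^+ i = delta_mx 0 i :> 'rV[F]_d.+1].
Proof.
have := companionmxK monP; have := @mulmx_delta_companion F P.
move: (companionmx P) (irrP.1); case: (size P) => [|[|d]] //= C _ C_delta charC.
exists d, C; split=> // [|i]; first by rewrite -charC Cayley_Hamilton.
case: i => i; elim: i => [|i IHi] lt_i.
  by rewrite expr0 mulmx1; congr delta_mx; apply: val_inj.
have lt_i' : (i < d.+1)%N by apply: ltnW.
by rewrite exprSr mulmxA (IHi lt_i') C_delta; congr delta_mx; apply: val_inj.
Qed.

Variables (d : nat) (C : 'M[F]_d.+1).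
Hypotheses (size_P : size P = d.+2) (CP : horner_mx C P = 0).
Hypothesis C_cyclic :
  forall i : 'I_d.+1, delta_mx 0 0 *m C ^+ i = delta_mx 0 i :> 'rV[F]_d.+1.

Lemma coprime_horner_unit n (A : 'M[F]_n.+1) (p : {poly F}) :
  horner_mx A P = 0 -> coprimep P p -> horner_mx A p \in unitmx.
Proof.
move=> AP /Bezout_eq1_coprimepP[[a b] /= ab1].
have : horner_mx A b *m horner_mx A p = 1%:M.
  have := congr1 (horner_mx A) ab1.
  by rewrite rmorphD !rmorphM rmorph1 /= AP mulr0 add0r.
by case/mulmx1_unit.
Qed.

Lemma horner_mx_rVpoly n (A : 'M[F]_n.+1) (w : 'rV[F]_d.+1) :
  horner_mx A (rVpoly w) = \sum_i w 0 i *: A ^+ i.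
Proof.
rewrite [rVpoly w]poly_def raddf_sum; apply: eq_bigr => i _.
by rewrite valK /= linearZ /= rmorphXn /= horner_mx_X.
Qed.

(** A nontrivial relation [u] between the rows [w *m C ^+ i] is a nonzero polynomial of degree below
    that of [P] that kills [w]. It is prime to [P], so it acts invertibly and [w = 0]. *)
Lemma row_orbit_unit (w : 'rV[F]_d.+1) :
  w != 0 -> (\matrix_(i < d.+1) (w *m C ^+ i)) \in unitmx.
Proof.
move=> w_neq0; rewrite -row_free_unit; apply: inj_row_free => u uK.
apply: contraNeq w_neq0 => u_neq0.
have up : rVpoly u != 0.
  by apply: contra_neq u_neq0 => u0; rewrite -[u]rVpolyK u0 linear0.
have cop : coprimep P (rVpoly u).
  rewrite irreducible_poly_coprime //; apply/negP => /(dvdp_leq up).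
  by rewrite size_P leqNgt ltnS size_poly.
rewrite -[w](mulmxK (coprime_horner_unit CP cop)) horner_mx_rVpoly.
suff -> : w *m (\sum_i u 0 i *: C ^+ i) = 0 by rewrite mul0mx.
rewrite -uK mulmx_sumr; apply/rowP => j; rewrite summxE !mxE.
by apply: eq_bigr => i _; rewrite -scalemxAr !mxE.
Qed.

(** A module map to [C] is determined by its first row [u], the other rows being [u *m A ^+ i]. The
    hypothesis on [u] makes this compatible with reduction modulo [P]. *)
Lemma cyclic_intertwine n (A : 'M[F]_n.+1) (u : 'rV[F]_n.+1) :
  u *m horner_mx A P = 0 ->
  exists2 f : 'M[F]_(d.+1, n.+1), f *m A = C *m f & delta_mx 0 0 *m f = u.
Proof.
move=> uP; pose f := \matrix_(i < d.+1) (u *m A ^+ i).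
have df i : delta_mx 0 i *m f = u *m A ^+ i by rewrite -rowE rowK.
have small (w : 'rV[F]_d.+1) :
  delta_mx 0 0 *m horner_mx C (rVpoly w) *m f = u *m horner_mx A (rVpoly w).
  rewrite !horner_mx_rVpoly !mulmx_sumr mulmx_suml; apply: eq_bigr => i _.
  by rewrite -!scalemxAr -scalemxAl C_cyclic df.
have all_p p : delta_mx 0 0 *m horner_mx C p *m f = u *m horner_mx A p.
  have -> : p = (p %/ P) * P + rVpoly (poly_rV (p %% P) : 'rV[F]_d.+1).
    rewrite poly_rV_K -?divp_eq // -ltnS -size_P ltn_modp.
    exact: irredp_neq0.
  rewrite !rmorphD !rmorphM /= CP mulr0 add0r mulmxDr small.
  have -> : horner_mx A (p %/ P) * horner_mx A P = horner_mx A P * horner_mx A (p %/ P).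
    by rewrite -!rmorphM mulrC.
  by rewrite (mulmxA u (horner_mx A P)) uP mul0mx add0r.
exists f; last by rewrite df expr0 mulmx1.
apply/row_matrixP => i; rewrite !rowE !mulmxA df -(C_cyclic i).
(* For [i = d] the exponent leaves the range of [small]; the reduction modulo [P] in [all_p] covers
   it. *)
have := all_p 'X^(i.+1); rewrite !rmorphXn /= !horner_mx_X => fi.
have XS k (B : 'M[F]_k.+1) : B ^+ i *m B = B ^+ i.+1 by rewrite exprSr.
by rewrite -(mulmxA _ (C ^+ i)) -mulmxA !XS fi.
Qed.

Lemma card_intertwine_cyclic n (A : 'M[F]_n.+1) :
  horner_mx A P = 0 ->
  #|[pred f : 'M[F]_(d.+1, n.+1) | f *m A == C *m f]| = (#|F| ^ n.+1)%N.
Proof.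
move=> AP; rewrite -card_rV.
have inj_row : {in [pred f : 'M[F]_(d.+1, n.+1) | f *m A == C *m f] &,
                injective (fun f => delta_mx 0 0 *m f : 'rV[F]_n.+1)}.
  move=> f g; rewrite !inE => /eqP fA /eqP gA fg0; apply/row_matrixP => i.
  rewrite !rowE -C_cyclic -!mulmxA -(intertwine_expr _ fA) -(intertwine_expr _ gA).
  by rewrite !mulmxA fg0.
rewrite -(card_in_image inj_row); apply: eq_card => u; rewrite inE.
have uP : u *m horner_mx A P = 0 by rewrite AP mulmx0.
have [f fA fu] := cyclic_intertwine uP.
by apply/fintype.imageP; exists f; rewrite // inE fA.
Qed.

(** If [P(A)] is invertible, every map has [f *m P(A) = P(C) *m f = 0], so [f = 0]. Otherwise a
    nonzero row killed by [P(A)] is the first row of a nonzero map. *)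
Lemma regular_intertwine n (A : 'M[F]_n) :
  regular_on (mx_module A) P <->
  #|[pred f : 'M[F]_(d.+1, n) | f *m A == C *m f]| = 1%N.
Proof.
case: n A => [|n] A.
  split=> [_|_ v _]; last by rewrite [LHS]flatmx0 [RHS]flatmx0.
  rewrite (eq_card (B := predT)) ?card_mx ?muln0 // => f.
  by rewrite !inE; apply/eqP; rewrite [LHS]thinmx0 [RHS]thinmx0.
split=> [regA|card1 v Pv].
  rewrite (eq_card (B := pred1 0)) ?card1 // => f; rewrite !inE.
  apply/eqP/eqP => [fA|->]; last by rewrite mul0mx mulmx0.
  have PA : horner_mx A P \in unitmx.
    rewrite -unitmx_tr -row_free_unit; apply: inj_row_free => w wP.
    apply: trmx_inj; rewrite trmx0; apply: regA.
    by rewrite [LHS]mx_scaleE -[LHS]trmxK trmx_mul trmxK wP trmx0.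
  apply: (row_free_inj (_ : row_free (horner_mx A P))); first by rewrite row_free_unit.
  have := CP; rewrite !horner_mx_sum => CPs.
  by rewrite (intertwine_sum _ _ fA) CPs !mul0mx.
apply/eqP; apply: contraT => v_neq0.
have /det0P[u u_neq0 uP] : \det (horner_mx A P) == 0.
  apply: contraNT v_neq0; rewrite -unitfE -unitmxE => PA.
  by rewrite -(mulKmx PA v) -mx_scaleE [mx_scale _ _]Pv mulmx0.
have [f fA fu] := cyclic_intertwine uP.
have /fintype.card_le1P/(_ 0 _ f) : (#|[pred f : 'M[F]_(d.+1, n.+1) | f *m A == C *m f]| <= 1)%N.
  by rewrite card1.
rewrite !inE mul0mx mulmx0 fA !eqxx => /(_ isT) /esym/eqP f0.
by rewrite -fu f0 mulmx0 eqxx in u_neq0.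
Qed.

(** The matrix of [K^i], where [K = F[t]/(P)] is the module of [C]. The size [i.+1 * d.+1] unfolds
    to [d.+1 + i * d.+1], so the block form typechecks by conversion. *)
Fixpoint diag_power i : 'M[F]_(i * d.+1) :=
  if i is j.+1 return 'M[F]_(i * d.+1) then block_mx C 0 0 (diag_power j) else 0.

Lemma diag_power_killed i (v : mx_module (diag_power i)) : P *: v = 0.
Proof.
elim: i v => [|i IHi] v; first by rewrite [LHS]flatmx0 [RHS]flatmx0.
have lin1 : linear (fun v : mx_module (diag_power i.+1) =>
    row_mx 1%:M 0 *m (v : 'cV[F]_(d.+1 + i * d.+1)) : mx_module C).
  apply: intertwine_linear.
  change (row_mx 1%:M 0 *m block_mx C 0 0 (diag_power i) = C *m row_mx 1%:M 0).
  rewrite mul_row_block mul_mx_row.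
  by rewrite !(mul1mx, mul0mx, mulmx1, mulmx0, addr0).
have lin2 : linear (fun v : mx_module (diag_power i.+1) =>
    row_mx 0 1%:M *m (v : 'cV[F]_(d.+1 + i * d.+1)) : mx_module (diag_power i)).
  apply: intertwine_linear.
  change (row_mx 0 1%:M *m block_mx C 0 0 (diag_power i) = diag_power i *m row_mx 0 1%:M).
  rewrite mul_row_block mul_mx_row.
  by rewrite !(mul1mx, mul0mx, mulmx1, mulmx0, addr0, add0r).
have := linear_mapZ lin2 P v; rewrite IHi.
have := linear_mapZ lin1 P v.
have -> (w : mx_module C) : P *: w = 0 by rewrite [LHS]mx_scaleE CP mul0mx.
move: (P *: v : 'cV[F]_(d.+1 + i * d.+1)) => u.
rewrite -[u]vsubmxK !mul_row_col !(mul1mx, mul0mx, addr0, add0r) => -> ->.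
by rewrite col_mx0.
Qed.

Lemma card_intertwine_diag_power i :
  #|[pred M : 'M[F]_(d.+1, i * d.+1) | M *m diag_power i == C *m M]| =
  ((#|F| ^ d.+1) ^ i)%N.
Proof.
elim: i => [|i IHi].
  rewrite (eq_card (B := predT)) ?card_mx ?muln0 ?expn0 // => f.
  by rewrite !inE; apply/eqP; rewrite [LHS]thinmx0 [RHS]thinmx0.
rewrite expnS -IHi -(card_intertwine_cyclic CP) -cardX.
pose X (p : 'M[F]_(d.+1, d.+1) * 'M[F]_(d.+1, i * d.+1)) : 'M[F]_(d.+1, i.+1 * d.+1) :=
  row_mx p.1 p.2.
have injX : injective X.
  by move=> [a b] [a' b'] /= /(@eq_row_mx F d.+1 d.+1 (i * d.+1) a b a' b')[-> ->].
rewrite -(fintype.card_image injX); apply: eq_card => M; rewrite inE.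
have XE (a : 'M[F]_(d.+1, d.+1)) (b : 'M[F]_(d.+1, i * d.+1)) :
  (X (a, b) *m diag_power i.+1 == C *m X (a, b)) =
  (a *m C == C *m a) && (b *m diag_power i == C *m b).
  change ((row_mx a b *m block_mx C 0 0 (diag_power i) == C *m row_mx a b) =
          (a *m C == C *m a) && (b *m diag_power i == C *m b)).
  rewrite mul_row_block mul_mx_row !(mulmx0, addr0, add0r).
  apply/eqP/andP => [/(@eq_row_mx F _ d.+1 (i * d.+1))[-> ->]//|].
  by case=> /eqP-> /eqP->.
apply/idP/fintype.imageP => [MC|[[a b]]]; last first.
  by rewrite inE /= !inE -XE => ab ->.
have ME : M = X (lsubmx (M : 'M[F]_(d.+1, d.+1 + i * d.+1)),
                 rsubmx (M : 'M[F]_(d.+1, d.+1 + i * d.+1))).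
  by rewrite /X /= hsubmxK.
exists (lsubmx (M : 'M[F]_(d.+1, d.+1 + i * d.+1)),
        rsubmx (M : 'M[F]_(d.+1, d.+1 + i * d.+1))) => //.
by rewrite inE /= !inE -XE -ME.
Qed.

Section Surjections.
Variables (n : nat) (A : 'M[F]_n).

(* A nonzero row w of C generates all rows, so a single dependence w g <= f
   propagates to g <= f. *)
Lemma row_free_extend h (T : 'M[F]_h) (g : 'M[F]_(d.+1, n)) (f : 'M[F]_(h, n)) :
  g *m A = C *m g -> f *m A = T *m f ->
  row_free (col_mx g f) = row_free f && ~~ (g <= f)%MS.
Proof.
move=> gA fA; apply/row_free_col_mx/andP => -[free_f gf]; split=> //.
  apply/negP => le_gf.
  have /matrixP/(_ 0 0)/eqP := gf (delta_mx 0 0) (submx_trans (submxMl _ _) le_gf).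
  by rewrite !mxE oner_eq0.
move=> w /submxP[v wv]; apply: contraNeq gf => /row_orbit_unit K_unit.
rewrite -(mulKmx K_unit g); apply: submx_trans (submxMl _ _) _.
apply/row_subP => i; rewrite row_mul rowK -mulmxA -(intertwine_expr _ gA).
by rewrite mulmxA wv -mulmxA (intertwine_expr _ fA) mulmxA submxMl.
Qed.

(** Such maps are the [M *m f] with [M] a module map from [K^i] to [K]. *)
Lemma card_intertwine_submx i (f : 'M[F]_(i * d.+1, n)) :
  f *m A = diag_power i *m f -> row_free f ->
  #|[predI [pred g : 'M[F]_(d.+1, n) | g *m A == C *m g] &
           [pred g : 'M[F]_(d.+1, n) | (g <= f)%MS]]| = ((#|F| ^ d.+1) ^ i)%N.
Proof.
move=> fA free_f; rewrite -(card_intertwine_diag_power i).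
rewrite -(fintype.card_image (row_free_inj (m := d.+1) free_f)).
apply: eq_card => g; rewrite !inE.
apply/andP/fintype.imageP => [[/eqP gA /submxP[M gM]]|[M]].
  exists M => //; rewrite inE; apply/eqP/(row_free_inj free_f).
  by rewrite -mulmxA -fA mulmxA -gM gA gM mulmxA.
rewrite inE => /eqP MT ->; rewrite submxMl; split=> //; apply/eqP.
by rewrite -mulmxA fA mulmxA MT mulmxA.
Qed.

(** Adjoining a map [g] to a surjection onto [K^i] gives a surjection onto [K^(i+1)] exactly when
    [g] does not factor through it. This excludes [|K|^i] choices of [g]. *)
Lemma card_surjections_diag_power i :
  #|[pred f : 'M[F]_(i * d.+1, n) | (f *m A == diag_power i *m f) && row_free f]| =
  (\prod_(s < i) (#|[pred g : 'M[F]_(d.+1, n) | g *m A == C *m g]| -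
                  (#|F| ^ d.+1) ^ s))%N.
Proof.
elim: i => [|i IHi].
  rewrite big_ord0 (eq_card (B := predT)) ?card_mx ?mul0n // => f.
  by rewrite !inE [f *m A]flatmx0 [diag_power 0 *m f]flatmx0 /row_free flatmx0 mxrank0 eqxx.
rewrite big_ord_recr /= -IHi.
set Hom := [pred g : 'M[F]_(d.+1, n) | g *m A == C *m g].
rewrite -(card_dependent_pairs
  (S := fun f : 'M[F]_(i * d.+1, n) => [predD Hom & [pred g : 'M[F]_(d.+1, n) | (g <= f)%MS]])).
  pose X (p : 'M[F]_(i * d.+1, n) * 'M[F]_(d.+1, n)) : 'M[F]_(i.+1 * d.+1, n) :=
    col_mx p.2 p.1.
  have injX : injective X.
    by move=> [f g] [f' g'] /= /(@eq_col_mx F d.+1 (i * d.+1) n g f g' f')[-> ->].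
  rewrite -(fintype.card_image injX); apply: eq_card => u; rewrite inE.
  have XE (f : 'M[F]_(i * d.+1, n)) (g : 'M[F]_(d.+1, n)) :
    (X (f, g) *m A == diag_power i.+1 *m X (f, g)) =
    (g *m A == C *m g) && (f *m A == diag_power i *m f).
    change ((col_mx g f *m A == block_mx C 0 0 (diag_power i) *m col_mx g f) =
            (g *m A == C *m g) && (f *m A == diag_power i *m f)).
    rewrite mul_block_col mul_col_mx !(mul0mx, addr0, add0r).
    apply/eqP/andP => [/(@eq_col_mx F d.+1 (i * d.+1))[-> ->]//|].
    by case=> /eqP-> /eqP->.
  have XE' f g : (X (f, g) *m A == diag_power i.+1 *m X (f, g)) && row_free (X (f, g)) =
     ((f *m A == diag_power i *m f) && row_free f) && ((g *m A == C *m g) && ~~ (g <= f)%MS).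
    rewrite XE; case: eqP => [gA|_] /=; last by rewrite andbF.
    case: eqP => //= fA.
    exact: row_free_extend gA fA.
  apply/idP/fintype.imageP => [uA|[[f g]]]; last first.
    by rewrite !inE /= [~~ _ && _]andbC -XE' => fg ->.
  have uE : u = X (dsubmx (u : 'M[F]_(d.+1 + i * d.+1, n)),
                   usubmx (u : 'M[F]_(d.+1 + i * d.+1, n))).
    by rewrite /X /= vsubmxK.
  exists (dsubmx (u : 'M[F]_(d.+1 + i * d.+1, n)),
          usubmx (u : 'M[F]_(d.+1 + i * d.+1, n))) => //.
  by rewrite !inE /= [~~ _ && _]andbC -XE' -uE.
move=> f /andP[/eqP fA free_f].
rewrite -(card_intertwine_submx fA free_f).
by rewrite -(cardID [pred g : 'M[F]_(d.+1, n) | (g <= f)%MS] Hom) addKn.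
Qed.

End Surjections.

End CompanionPowers.

(** * Euler sums *)

Section EulerSums.
Variable R : realType.
Implicit Types (q y : R) (n i : nat).

(** The terms of Euler's series: for [1 < q] they sum to [prod_(l >= 1) (1 - q^-l)]. *)
Definition euler_coef q i : R := (-1) ^+ i / \prod_(l < i) (q ^+ l.+1 - 1).

Lemma exprn_sub1_gt0 q l : 1 < q -> 0 < q ^+ l.+1 - 1.
Proof. by move=> q1; rewrite subr_gt0 exprn_egt1. Qed.

Lemma euler_coefS q i : 1 < q -> euler_coef q i.+1 * (q ^+ i.+1 - 1) = - euler_coef q i.
Proof.
move=> q1; rewrite /euler_coef big_ord_recr /= exprS.
have := exprn_sub1_gt0 i q1; have : 0 < \prod_(l < i) (q ^+ l.+1 - 1).
  by apply: prodr_gt0 => l _; apply: exprn_sub1_gt0.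
by move=> /lt0r_neq0 ? /lt0r_neq0 ?; field; apply/andP.
Qed.

(** Truncated form of the q-binomial identity; the right side vanishes when [y = q^k] with
    [1 <= k <= n]. *)
Lemma euler_sum_telescope q y n : 1 < q ->
  \sum_(i < n.+1) euler_coef q i * \prod_(s < i) (y - q ^+ s) =
  euler_coef q n * \prod_(s < n) (y - q ^+ s.+1).
Proof.
move=> q1; elim: n => [|n IHn]; first by rewrite big_ord1 !big_ord0.
rewrite big_ord_recr /= IHn big_ord_recl /= expr0 [in RHS]big_ord_recr /=.
set p := \prod_(s < n) _.
have -> : euler_coef q n = - (euler_coef q n.+1 * (q ^+ n.+1 - 1)).
  by rewrite euler_coefS ?opprK.
rewrite -/p; ring.
Qed.

(** The factors [q^l - 1] are at least 2 for [l >= 2]. The numerator 2 compensates for [l = 1],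
    where the factor may be 1. *)
Lemma euler_coef_le q i : 2 <= q -> `|euler_coef q i| <= 2 / 2 ^+ i.
Proof.
move=> q2; have q1 : 1 < q by apply: lt_le_trans q2; rewrite ltr1n.
elim: i => [|i IHi]; first by rewrite /euler_coef big_ord0 expr0 !divr1 normr1 ler1n.
have := congr1 Num.norm (euler_coefS i q1); rewrite normrN normrM.
rewrite (gtr0_norm (exprn_sub1_gt0 i q1)) => ai.
case: i => [|i] in IHi ai *.
  by rewrite expr1 divff // /euler_coef big_ord1 !expr1 normrM normrN1 mul1r normfV
     gtr0_norm ?invf_le1 ?subr_gt0 // lerBrDr.
have : 2 <= q ^+ i.+2 - 1.
  have : 2 ^+ 2 <= q ^+ i.+2.
    apply: (le_trans (y := q ^+ 2)); first by rewrite lerXn2r ?nnegrE //; lra.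
    by rewrite ler_eXn2l.
  lra.
move=> ge2; have : `|euler_coef q i.+2| * 2 <= 2 / 2 ^+ i.+1.
  by apply: le_trans IHi; rewrite -ai; apply: ler_wpM2l.
rewrite [in X in _ -> X]exprS invfM; move: (2 ^+ i.+1)^-1 => e; lra.
Qed.

Lemma surj_densityS q n i :
  surj_density q n i.+1 = surj_density q n i * (1 - q ^+ i / q ^+ n).
Proof. by rewrite /surj_density big_ord_recr. Qed.

Lemma surj_densitySS q n i : q != 0 ->
  surj_density q n.+1 i.+1 = (1 - q ^- n.+1) * surj_density q n i.
Proof.
move=> q0; rewrite /surj_density big_ord_recl /= expr0 div1r; congr (_ * _).
apply: eq_bigr => s _; rewrite /bump /= add1n !exprS invfM mulrACA divff //.
by rewrite mul1r.
Qed.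

(** Summation by parts gives [X = q^-(n+1) X] for the sum [X] below, so [X = 0], and the difference
    of the two sides is a multiple of [X]. The bound on [m] makes the boundary term vanish. *)
Lemma euler_finite_rec q n m : 1 < q -> (n.+1 < m)%N ->
  \sum_(i < m.+1) euler_coef q i * surj_density q n.+1 i =
  (1 - q ^- n.+1) * \sum_(i < m.+1) euler_coef q i * surj_density q n i.
Proof.
move=> q1 lt_nm; have q0 : q != 0 by rewrite gt_eqF // (lt_trans ltr01).
set c := surj_density q n.+1; set a := euler_coef q.
have cS i : c i - c i.+1 = q ^- n.+1 * (q ^+ i * c i).
  by rewrite /c surj_densityS; field; rewrite expf_neq0.
pose X := \sum_(i < m.+1) a i * q ^+ i * c i.
have X_diff : \sum_(i < m.+1) a i * (c i - c i.+1) = q ^- n.+1 * X.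
  by rewrite mulr_sumr; apply: eq_bigr => i _; rewrite cS; ring.
have cm : c m = 0 by rewrite /c surj_density_small.
have cm1 : c m.+1 = 0 by rewrite /c surj_density_small // ltnW.
have XE : X = \sum_(i < m.+1) a i * (c i - c i.+1).
  rewrite /X big_ord_recl [RHS](eq_bigr (fun i : 'I_m.+1 => a i * c i - a i * c i.+1)); last first.
    by move=> i _; rewrite mulrBr.
  rewrite sumrB big_ord_recl [X in _ - X]big_ord_recr /= cm1 mulr0 addr0 expr0 mulr1.
  rewrite -addrA; congr (_ + _); rewrite -sumrB.
  apply: eq_bigr => i _.
  rewrite /bump /= add1n; have := euler_coefS i q1; rewrite -/a => ai.
  have -> : a i = - (a i.+1 * (q ^+ i.+1 - 1)) by rewrite ai opprK.
  ring.
have X0 : X = 0.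
  have : (1 - q ^- n.+1) * X = 0 by rewrite mulrBl mul1r -X_diff -XE subrr.
  move/eqP; rewrite mulf_eq0 => /orP[|/eqP//].
  by rewrite subr_eq0 eq_sym invr_eq1 gt_eqF // exprn_egt1.
apply/eqP; rewrite -subr_eq0 mulr_sumr -sumrB; apply/eqP.
transitivity (q ^- n.+1 * X); last by rewrite X0 mulr0.
rewrite -X_diff; apply: eq_bigr => i _.
by rewrite [c i.+1]surj_densitySS //; ring.
Qed.

(** When [q] is the order of a field, the right side is the density of invertible matrices of size
    [n]. Later the density sum is compared with this finite identity term by term. *)
Lemma euler_finite q n : 1 < q ->
  \sum_(i < n.+1) euler_coef q i * surj_density q n i =
  \prod_(1 <= l < n.+1) (1 - q ^- l).
Proof.
move=> q1; have q0 : q != 0 by rewrite gt_eqF // (lt_trans ltr01).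
(* Summands with [i > m] vanish, so the range can be padded to meet [euler_finite_rec]. *)
have widen m k : (m <= k)%N ->
  \sum_(i < k.+1) euler_coef q i * surj_density q m i =
  \sum_(i < m.+1) euler_coef q i * surj_density q m i.
  move=> le_mk; rewrite -!(big_mkord predT (fun i => euler_coef q i * surj_density q m i)).
  rewrite (big_cat_nat (leq0n m.+1)) //= [X in _ + X]big_nat_cond [X in _ + X]big1 ?addr0 //.
  by move=> i /andP[/andP[lt_mi _] _]; rewrite surj_density_small // mulr0.
elim: n => [|n IHn].
  by rewrite big_ord1 big_geq // /euler_coef /surj_density !big_ord0 divr1 mulr1.
rewrite big_nat_recr //= -IHn -(widen n n.+2); last by lia.
by rewrite mulrC -euler_finite_rec // widen.
Qed.

End EulerSums.

(** * Limits and dominated convergence of sums *)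

Section Limits.
Variable R : realType.
Implicit Types (q : R) (n i : nat).

Lemma surj_density_ge0 q n i : 1 < q -> 0 <= surj_density q n i.
Proof.
move=> q1; have q0 : q != 0 by rewrite gt_eqF // (lt_trans ltr01).
have [le_in|lt_ni] := leqP i n; last by rewrite surj_density_small.
apply: prodr_ge0 => s _; rewrite subr_ge0 ler_pdivrMr ?exprn_gt0 ?(lt_trans ltr01) //.
by rewrite mul1r ler_eXn2l // ltnW // (leq_trans (ltn_ord s)).
Qed.

Lemma surj_density_le1 q n i : 1 < q -> surj_density q n i <= 1.
Proof.
move=> q1; have q0 : 0 < q by apply: lt_trans q1.
have [le_in|lt_ni] := leqP i n; last by rewrite surj_density_small ?gt_eqF.
apply: prodr_ile1 => s _; rewrite subr_ge0 ler_pdivrMr ?exprn_gt0 //.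
rewrite mul1r ler_eXn2l // (ltnW (leq_trans (ltn_ord s) _)) //=.
by rewrite gerBl divr_ge0 ?exprn_ge0 // ltW.
Qed.

Lemma cvg_surj_density q i : 1 < q -> surj_density q n i @[n --> \oo] --> (1 : R).
Proof.
move=> q1; have q0 : 0 < q by apply: lt_trans q1.
elim: i => [|i IHi].
  rewrite (_ : (fun n => _) = fun=> 1); first exact: cvg_cst.
  by apply/funext => n; rewrite /surj_density big_ord0.
rewrite (_ : (fun n => _) = fun n => surj_density q n i * (1 - q ^+ i * q^-1 ^+ n)); last first.
  by apply/funext => n; rewrite surj_densityS exprVn.
rewrite -[X in _ --> X]mulr1; apply: cvgM => //.
rewrite -[X in _ --> X]subr0; apply: cvgB; first exact: cvg_cst.
rewrite -(mulr0 (q ^+ i)); apply: cvgM; first exact: cvg_cst.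
by apply: cvg_expr; rewrite gtr0_norm ?invr_gt0 // invf_lt1.
Qed.

(** Split the sum at [I]: the tail is bounded by a geometric series uniformly in [n], and the head
    is a fixed finite sum of null sequences. *)
Lemma tannery (a : nat -> R) (z : nat -> nat -> R) (M B : R) :
  (forall i, `|a i| <= M / 2 ^+ i) -> (forall n i, `|z n i| <= B) ->
  (forall i, z n i @[n --> \oo] --> (0 : R)) ->
  \sum_(i < n.+1) a i * z n i @[n --> \oo] --> (0 : R).
Proof.
move=> aM zB z0.
have M0 : 0 <= M by have := aM 0%N; rewrite expr0 divr1; apply: le_trans.
have B0 : 0 <= B by apply: le_trans (zB 0 0)%N.
(* The geometric remainder is subtracted so that the induction closes; [(I + n).-1] is the row whose
   sum stops before [I + n]. *)
have tail I n : \sum_(I <= i < I + n) `|a i * z (I + n).-1 i| <=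
    M * B * 2 / 2 ^+ I - M * B * 2 / 2 ^+ (I + n).
  move: (I + n).-1 => k; elim: n => [|n IHn]; first by rewrite addn0 big_geq // subrr.
  rewrite addnS big_nat_recr ?leq_addr //=.
  have : `|a (I + n)%N * z k (I + n)%N| <= M / 2 ^+ (I + n) * B.
    by rewrite normrM; apply: ler_pM.
  rewrite exprS invfM; move: IHn.
  move: (\sum_(_ <= _ < _) _) `|_| (2 ^+ (I + n))^-1 => s t e; nra.
apply/cvgrPdist_lt => e e0.
have [I] : exists I : nat, M * B * 2 / 2 ^+ I < e / 2.
  have : M * B * 2 * 2^-1 ^+ n @[n --> \oo] --> M * B * 2 * 0.
    apply: cvgM; first exact: cvg_cst.
    by apply: cvg_expr; rewrite gtr0_norm; lra.
  rewrite mulr0 => /cvgrPdist_lt/(_ (e / 2)) [|I _ /(_ I (leqnn I))]; first lra.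
  rewrite /= sub0r normrN exprVn => lt_e; exists I.
  exact: le_lt_trans (ler_norm _) lt_e.
move=> lt_I.
have : \sum_(i < I) a i * z n i @[n --> \oo] --> (0 : R).
  elim: (I) => [|J IHJ].
    rewrite (_ : (fun n => _) = fun=> 0); first exact: cvg_cst.
    by apply/funext => n; rewrite big_ord0.
  rewrite (_ : (fun n => _) = fun n => \sum_(i < J) a i * z n i + a J * z n J); last first.
    by apply/funext => n; rewrite big_ord_recr.
  rewrite -[X in _ --> X]addr0; apply: cvgD => //.
  by rewrite -(mulr0 (a J)); apply: cvgM; [exact: cvg_cst | exact: z0].
move=> /cvgrPdist_lt/(_ (e / 2)) [|N _ ltN]; first lra.
exists (N + I)%N => // n /= le_n.
have le_In : (I <= n.+1)%N by apply/leqW/(leq_trans (leq_addl N I)).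
rewrite sub0r normrN -(big_mkord predT (fun i => a i * z n i)) (big_cat_nat (leq0n I)) //=.
rewrite big_mkord.
have lt1 : `|\sum_(i < I) a i * z n i| < e / 2.
  by have := ltN n (leq_trans (leq_addr _ _) le_n); rewrite /= sub0r normrN.
have := tail I (n.+1 - I)%N; rewrite subnKC //=.
have e1 : 0 <= M * B * 2 / 2 ^+ n.+1 by rewrite divr_ge0 ?exprn_ge0 ?mulr_ge0.
have := ler_norm_sum (index_iota I n.+1) (fun i => a i * z n i) xpredT.
have := ler_normD (\sum_(i < I) a i * z n i) (\sum_(I <= i < n.+1) a i * z n i).
lra.
Qed.

End Limits.

(** * Modules of finite length *)

Section Span.
Variables (R : comNzRingType) (M : lmodType R).

Fixpoint spanned (s : seq M) (y : M) : Prop :=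
  if s is x :: s' then exists a, spanned s' (y - a *: x) else y = 0.

Definition span_pred s : {pred M} := [pred y | `[< spanned s y >]].

Lemma span_pred_closed s : submod_closed (span_pred s).
Proof.
split=> [|a u v].
  by apply/asboolP; elim: s => //= x s IHs; exists 0; rewrite scale0r subrr.
move=> /asboolP su /asboolP sv; apply/asboolP.
elim: s u v su sv => [|x s IHs] u v /=; first by move=> -> ->; rewrite scaler0 addr0.
move=> [b su] [c sv]; exists (a * b + c); have := IHs _ _ su sv.
by congr spanned; rewrite scalerBr scalerDl -scalerA opprD addrACA.
Qed.

HB.instance Definition _ s :=
  GRing.isSubmodClosed.Build R M (span_pred s) (span_pred_closed s).

(** Otherwise one can keep adjoining an element outside the current span, which gives strict chains
    of every length. *)
Lemma finite_length_spanned : finite_length M -> exists s, forall y, spanned s y.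
Proof.
move=> [l chain_le]; apply: contrapT => /forallNP nspan.
have /choice[g gN] : forall s, exists y, ~ spanned s y by move=> s; apply/existsNP.
pose s i := iter i (fun s => g s :: s) [::].
suff : (l.+1 <= l)%N by rewrite ltnn.
apply: (chain_le _ (fun i => span_pred (s i) : submodClosed M)) => i _; split.
  move=> y /asboolP sy; apply/asboolP; exists 0.
  by rewrite scale0r subr0.
move=> /(_ (g (s i))) sub; apply: (gN (s i)); apply/asboolP/sub/asboolP.
exists 1; rewrite scale1r subrr.
by have /asboolP := (span_pred_closed (s i)).1.
Qed.

End Span.

Section TorsionMatrix.
Variables (F : fieldType) (P : {poly F}) (H : lmodType {poly F}).

Let F_linear m (g : 'rV[F]_m -> H) :=
  forall c u v, g (c *: u + v) = c%:P *: g u + g v.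

Let F_generated m := exists2 g : 'rV[F]_m -> H, F_linear g & forall y, exists v, g v = y.

(** If [P ^+ k] kills a generator, its multiples are already given by remainders modulo [P ^+ k],
    that is, by finitely many coefficients. *)
Lemma spanned_F_generated (s : seq H) : P != 0 -> is_torsion H P ->
  exists m, exists2 g : 'rV[F]_m -> H, F_linear g &
    forall y, spanned s y -> exists v, g v = y.
Proof.
move=> P0 torH; elim: s => [|x s [m [g lin_g gs]]] /=.
  exists 0%N, (fun=> 0); first by move=> c u v; rewrite scaler0 addr0.
  by move=> y ->; exists 0.
have /torsion_predP[k kx] := torH x; pose d := size (P ^+ k).
exists (d + m)%N, (fun w => rVpoly (lsubmx w : 'rV[F]_d) *: x + g (rsubmx w)).
  move=> c u v; rewrite !linearD !linearZ /= -mul_polyC lin_g scalerDl.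
  by rewrite addrACA !scalerA (mulrC c%:P).
move=> y [a /gs[v gv]]; exists (row_mx (poly_rV (a %% P ^+ k)) v).
rewrite row_mxKl row_mxKr gv poly_rV_K; last first.
  by rewrite ltnW // ltn_modp expf_neq0.
by rewrite {2}(divp_eq a (P ^+ k)) scalerDl -scalerA kx scaler0 add0r addrC subrK.
Qed.

(** Take the least possible dimension. A nonzero [w] sent to 0 would allow restriction to a
    complement of [w], of smaller dimension. *)
Lemma F_generated_basis m : F_generated m ->
  exists m', exists2 g : 'rV[F]_m' -> H, F_linear g & bijective g.
Proof.
move=> gen_m; have ex_m : exists n, `[< F_generated n >] by exists m; apply/asboolP.
case: (ex_minnP ex_m) => n /asboolP[g lin_g g_surj] min_n.
have gB u v : g (u - v) = g u - g v.
  by rewrite (addrC u) -(scaleN1r v) lin_g polyCN scaleN1r addrC.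
exists n, g => //; apply: inj_surj_bijective => // u v guv.
apply/eqP; rewrite -subr_eq0; apply: contraT => uv_neq0.
have guv0 : g (u - v) = 0 by rewrite gB guv subrr.
move: (u - v) uv_neq0 guv0 => w w_neq0 gw.
have n_gt0 : (0 < n)%N.
  by case: n w w_neq0 {gw g_surj gB lin_g min_n g u v guv} => // w; rewrite thinmx0 eqxx.
pose B := row_base (w^C)%MS.
suff /asboolP/min_n : F_generated (\rank (w^C)%MS).
  by rewrite mxrank_compl rank_rV w_neq0 leqNgt subn1 ltn_predL n_gt0.
exists (fun z => g (z *m B)) => [c z z'|y]; first by rewrite mulmxDl -scalemxAl lin_g.
have [z gz] := g_surj y.
have /sub_addsmxP[[a b] /= zE] : (z <= w + w^C)%MS.
  by rewrite submx_full // addsmx_compl_full.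
have /submxP[b' bE] : (b *m w^C%MS <= B)%MS by rewrite eq_row_base submxMl.
exists b'; rewrite -bE -gz zE [a]mx11_scalar mul_scalar_mx.
by rewrite lin_g gw scaler0 add0r.
Qed.

(** In [F]-coordinates multiplication by ['X] is a matrix [T]. Transposes pass between the row
    coordinates of [g] and the columns of [mx_module T]. *)
Lemma torsion_finite_length_matrix :
  P != 0 -> is_torsion H P -> finite_length H ->
  exists h, exists T : 'M[F]_h, mod_iso (mx_module T) H.
Proof.
move=> P0 torH /finite_length_spanned[s Hs].
have [m [g0 lin_g0 g0s]] := spanned_F_generated s P0 torH.
have [|h [g lin_g [g' gK g'K]]] := @F_generated_basis m.
  by exists g0 => // y; apply: g0s.
have gC c u : g (c *: u) = c%:P *: g u.
  have g_0 : g 0 = 0 by have := lin_g (-1) 0 0; rewrite scaler0 addr0 polyCN scaleN1r addNr.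
  by rewrite -[c *: u]addr0 lin_g g_0 addr0.
have gD u v : g (u + v) = g u + g v.
  by rewrite -[u]scale1r lin_g !scale1r.
have lin_X : linear (fun v : 'cV[F]_h => (g' ('X *: g v^T))^T).
  move=> c u v; apply: trmx_inj; rewrite trmxK [RHS]linearP /= !trmxK.
  apply: (can_inj gK); rewrite lin_g !g'K [(c *: u + v)^T]linearP /= lin_g.
  by rewrite scalerDr !scalerA mulrC.
have [T TE] := linear_cV_mulmx lin_X; exists h, T; apply/mod_isoP.
exists (fun v : mx_module T => g v^T).
  apply: poly_linear => [u v|c u|u]; first by rewrite linearD gD.
    by rewrite mx_module_scaleC linearZ gC.
  by rewrite mx_module_scaleX -TE trmxK g'K.
exists (fun y => (g' y)^T) => [v|y]; first by rewrite gK trmxK.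
by rewrite trmxK g'K.
Qed.

End TorsionMatrix.

(** * The limit *)

Section KernelExact.
Variables (F : fieldType) (h n m : nat) (A : 'M[F]_n) (B : 'M[F]_m) (T : 'M[F]_h).
Variables (f : 'M[F]_(h, n)) (k : 'M[F]_(n, m)).
Hypotheses (fA : f *m A = T *m f) (Ak : A *m k = k *m B) (fk : is_kernel f k).

Let lin_f := intertwine_linear fA.
Let lin_k := intertwine_linear (esym Ak).

Lemma regular_on_kernel D :
  regular_on (mx_module T) D ->
  regular_on (mx_module A) D <-> regular_on (mx_module B) D.
Proof. exact: (regular_on_exact lin_k lin_f fk.1 fk.2). Qed.

Lemma torsion_part_kernel D :
  regular_on (mx_module T) D ->
  mod_iso (torsion_part (mx_module B) D) (torsion_part (mx_module A) D).
Proof. exact: (torsion_part_exact lin_k lin_f fk.1 fk.2). Qed.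

Lemma regular_ker_kernel D : regular_ker A D f <-> regular_on (mx_module B) D.
Proof.
split=> [reg v Dv|reg v /fk.2[w <-] Dw].
  apply: fk.1; rewrite mulmx0; apply: reg; first by apply/fk.2; exists v.
  by rewrite -(linear_mapZ lin_k) Dv mulmx0.
rewrite (reg w) ?mulmx0 //; apply: fk.1; rewrite mulmx0.
by rewrite -(linear_mapZ lin_k) in Dw.
Qed.

End KernelExact.

Lemma is_torsion_iso (R : comNzRingType) (M N : lmodType R) (D : R) :
  mod_iso M N -> is_torsion N D -> is_torsion M D.
Proof.
move=> /mod_isoP[f lin_f bij_f] torN v; have /torsion_predP[k kv] := torN (f v).
apply/torsion_predP; exists k; apply: (bij_inj bij_f).
by rewrite linear_mapZ // kv linear_map0.
Qed.

Section Recursion.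
Variables (R : realType) (F : finFieldType) (r : nat).
Variables (P : 'I_r -> {poly F}) (H : 'I_r -> lmodType {poly F}).
Hypotheses (P_monic : forall j, P j \is monic)
  (P_irr : forall j, irreducible_poly (P j)) (P_inj : injective P).

Let q : R := #|F|%:R.

Let q_gt1 : 1 < q. Proof. by rewrite ltr1n card_finNzRing_gt1. Qed.

Lemma coprime_P j l : j != l -> coprimep (P j) (P l).
Proof. by move=> jl; rewrite monic_irreducible_coprime // (inj_eq P_inj). Qed.

(** The state of the induction: [s] lists the indices with a prescribed part, [t] those where the
    condition has been replaced by injectivity. *)
Definition has_local_type (s t : seq 'I_r) m : pred 'M[F]_m := fun B =>
  all (fun j => `[< mod_iso (torsion_part (mx_module B) (P j)) (H j) >]) s &&
  all (fun j => `[< regular_on (mx_module B) (P j) >]) t.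

Lemma has_local_type_kernel s t h n m (A : 'M[F]_n) (B : 'M[F]_m) (T : 'M[F]_h)
    (f : 'M[F]_(h, n)) (k : 'M[F]_(n, m)) :
  f *m A = T *m f -> A *m k = k *m B -> is_kernel f k ->
  (forall j, j \in s ++ t -> regular_on (mx_module T) (P j)) ->
  has_local_type s t A = has_local_type s t B.
Proof.
move=> fA Ak fk regT; congr (_ && _); apply: eq_in_all => j j_in; apply/asbool_equiv_eq.
  have iso_BA := torsion_part_kernel fA Ak fk (regT j _).
  have {}iso_BA : mod_iso (torsion_part (mx_module B) (P j))
                          (torsion_part (mx_module A) (P j)).
    by apply: iso_BA; rewrite mem_cat j_in.
  split; first exact: mod_iso_trans.
  by apply: mod_iso_trans; apply: mod_iso_sym.
by apply: (regular_on_kernel fA Ak fk); apply: regT; rewrite mem_cat j_in orbT.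
Qed.

(** Each admissible [A] carries [card_aut (H j)] surjections onto [T] with [P j] injective on the
    kernel. The other polynomials act injectively on [T], so the remaining conditions depend only on
    the kernel. *)
Lemma density_torsion_step s t j n h (T : 'M[F]_h) :
  is_torsion (H j) (P j) -> mod_iso (mx_module T) (H j) -> j \notin s ++ t ->
  mx_density R (@has_local_type (j :: s) t n) =
  (card_aut (H j))%:R^-1 *
    (surj_density q n h *
     mx_density R (@has_local_type s (j :: t) (n - h))).
Proof.
move=> torH isoT jst; have torT := is_torsion_iso isoT torH.
have regT l : l \in s ++ t -> regular_on (mx_module T) (P l).
  move=> lst; apply: coprime_torsion_regular torT (coprime_P _).
  by apply: contraNneq jst => ->.
rewrite -(density_surjection_pairs R (T := T)
    (E := fun A f => has_local_type s t A && `[< regular_ker A (P j) f >])); last first.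
  move=> A B f k fA Ak fk; rewrite (has_local_type_kernel fA Ak fk regT).
  rewrite /has_local_type /= -andbA; congr (_ && _).
  by rewrite andbC; congr (_ && _); apply/asbool_equiv_eq/(regular_ker_kernel Ak fk).
rewrite /mx_density mulrA; congr (_ / _).
have aut_neq0 : (card_aut (H j))%:R != 0 :> R.
  rewrite pnatr_eq0 -lt0n (card_autE isoT); apply/card_gt0P; exists 1%:M.
  by rewrite !inE mul1mx mulmx1 eqxx row_free_unit unitmx1.
apply: (mulfI aut_neq0); rewrite mulrA divff // mul1r -natrM; congr _%:R.
rewrite (card_autE isoT) -(sum1_card (@has_local_type (j :: s) t n)) big_distrr /=.
rewrite [LHS]big_mkcond /=.
apply: eq_bigr => A _.
have -> : #|[pred f : 'M[F]_(h, n) | [&& f *m A == T *m f, row_free f &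
    has_local_type s t A && `[< regular_ker A (P j) f >]]]| =
  (has_local_type s t A * #|[pred f : 'M[F]_(h, n) | [&& f *m A == T *m f, row_free f &
     `[< regular_ker A (P j) f >]]]|)%N.
  case: (has_local_type s t A); rewrite ?mul1n ?mul0n //=.
  by apply: eq_card0 => f; rewrite !inE !andbF.
rewrite (card_regular_surjections A (P_irr j) torT).
have -> : `[< mod_iso (torsion_part (mx_module A) (P j)) (mx_module T) >] =
          `[< mod_iso (torsion_part (mx_module A) (P j)) (H j) >].
  apply: asbool_equiv_eq; split=> iso_A; first exact: mod_iso_trans isoT.
  exact: mod_iso_trans (mod_iso_sym isoT).
rewrite -topredE /= /has_local_type /= -andbA.
rewrite -[all _ s && _]/(has_local_type s t A).
by case: asboolP => _; case: has_local_type; rewrite ?muln1 ?mul1n ?mul0n ?muln0.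
Qed.

(** With [y] the number of maps from [A] to [K], the sum is 1 if [y = 1], as only [i = 0]
    contributes; otherwise its telescoped form vanishes. *)
Lemma regular_indicator j d (C : 'M[F]_d.+1) n (A : 'M[F]_n) :
  size (P j) = d.+2 -> horner_mx C (P j) = 0 ->
  (forall i : 'I_d.+1, delta_mx 0 0 *m C ^+ i = delta_mx 0 i :> 'rV[F]_d.+1) ->
  `[< regular_on (mx_module A) (P j) >]%:R =
  \sum_(i < n.+1) euler_coef (q ^+ d.+1) i *
    #|[pred f : 'M[F]_(i * d.+1, n) | (f *m A == diag_power C i *m f) && row_free f]|%:R.
Proof.
move=> size_P CP C_cyclic; set y := #|[pred g : 'M[F]_(d.+1, n) | g *m A == C *m g]|.
have Q1 : 1 < q ^+ d.+1 by rewrite exprn_egt1.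
(* Truncated subtraction is harmless: a surjection onto [K^i] forces [|K|^i <= y], and without one
   both sides are 0. *)
have cardE i : #|[pred f : 'M[F]_(i * d.+1, n) |
                   (f *m A == diag_power C i *m f) && row_free f]|%:R =
               \prod_(s < i) (y%:R - (q ^+ d.+1) ^+ s) :> R.
  have card_S := card_surjections_diag_power (P_irr j) size_P CP C_cyclic A.
  elim: i => [|i IHi]; first by rewrite card_S !big_ord0.
  rewrite [RHS]big_ord_recr /= -IHi (card_S i.+1) big_ord_recr /= -card_S natrM.
  set S := [pred f : 'M[F]_(i * d.+1, n) | _].
  have [-> |/card_gt0P[f]] := posnP #|S|; first by rewrite !mul0r.
  rewrite inE => /andP[/eqP fA free_f]; congr (_ * _).
  rewrite natrB; first by rewrite !natrX.
  rewrite -(card_intertwine_submx (P_irr j) size_P CP C_cyclic fA free_f).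
  by apply/subset_leq_card/fintype.subsetP => g; rewrite !inE => /andP[].
rewrite (eq_bigr (fun i : 'I_n.+1 => euler_coef (q ^+ d.+1) i *
  \prod_(s < i) (y%:R - (q ^+ d.+1) ^+ s))) => [|i _]; last by rewrite cardE.
have regE := regular_intertwine (P_irr j) size_P CP C_cyclic A.
case: asboolP => [/regE y1|nreg].
  rewrite /y y1 big_ord_recl big_ord0 mulr1 big1 ?addr0 => [|i _]; last first.
    by rewrite lift0 big_ord_recl expr0 subrr mul0r mulr0.
  by rewrite /euler_coef big_ord0 divr1.
rewrite euler_sum_telescope //.
(* By dimension there is no surjection onto [K^(n+1)], so the product of the [y - |K|^s] over
   [s <= n] is 0. If [y] is not 1, the factor at [s = 0] is nonzero, and the others form the
   telescoped product. *)
have := cardE n.+1; rewrite eq_card0 => [|f]; last first.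
  rewrite !inE; apply/negP => /andP[_ /eqP rf]; have := rank_leq_col f.
  by rewrite rf leqNgt mulSn addSn ltnS (leq_trans (leq_pmulr n (ltn0Sn d))) ?leq_addl.
rewrite big_ord_recl expr0 => /esym/eqP; rewrite mulf_eq0 => /orP[|/eqP ->]; last first.
  by rewrite mulr0.
by rewrite subr_eq0 pnatr_eq1 => /eqP/regE.
Qed.

(** Average [regular_indicator] over the matrices meeting the conditions in [t], and apply the pair
    count to each [K^i], on which the polynomials of [t] act injectively. *)
Lemma density_regular_step t j n : j \notin t ->
  mx_density R (@has_local_type [::] (j :: t) n) =
  \sum_(i < n.+1) euler_coef (q ^+ (size (P j)).-1) i *
    (surj_density q n (i * (size (P j)).-1) *
     mx_density R (@has_local_type [::] t (n - i * (size (P j)).-1))).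
Proof.
move=> jt; have [d [C [size_P CP C_cyclic]]] := companion_exists (P_irr j) (P_monic j).
rewrite size_P /=.
rewrite (eq_bigr (fun i : 'I_n.+1 => (\sum_(A : 'M[F]_n) euler_coef (q ^+ d.+1) i *
   #|[pred f : 'M[F]_(i * d.+1, n) | [&& f *m A == diag_power C i *m f, row_free f
      & has_local_type [::] t A]]|%:R) / #|{: 'M[F]_n}|%:R)) => [|i _]; last first.
  rewrite -(density_surjection_pairs R (T := diag_power C i)
    (E := fun A f => has_local_type [::] t A)).
    by rewrite mulrA natr_sum mulr_sumr.
  move=> A B f k fA Ak fk; apply: (has_local_type_kernel fA Ak fk) => l /= lt.
  have torT : is_torsion (mx_module (diag_power C i)) (P j).
    move=> v; apply/torsion_predP; exists 1%N; rewrite expr1.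
    exact: (diag_power_killed CP).
  apply: coprime_torsion_regular torT (coprime_P _).
  by apply: contraNneq jt => ->.
rewrite -mulr_suml /mx_density; congr (_ / _).
rewrite exchange_big /= -sum1_card natr_sum big_mkcond /=; apply: eq_bigr => A _.
transitivity ((has_local_type [::] t A)%:R * `[< regular_on (mx_module A) (P j) >]%:R : R).
  rewrite -topredE /= /has_local_type /=.
  by case: (all _ t); case: asboolP => _; rewrite ?mulr1 ?mulr0.
rewrite (regular_indicator A size_P CP C_cyclic) mulr_sumr; apply: eq_bigr => i _.
rewrite mulrCA; congr (_ * _); case: has_local_type; rewrite ?mul1r ?mul0r.
  by congr _%:R; apply: eq_card => f; rewrite !inE andbT.
by rewrite eq_card0 // => f; rewrite !inE !andbF.
Qed.

End Recursion.

Lemma cvg_euler_product (R : realType) (Q : R) : 1 < Q ->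
  cvg ((fun n => \prod_(1 <= l < n.+1) (1 - Q ^- l)) @ \oo).
Proof.
move=> Q1; have Q0 : 0 < Q by apply: lt_trans Q1.
have fac0 l : 0 <= 1 - Q ^- l by rewrite subr_ge0 invf_le1 ?exprn_gt0 ?exprn_ege1 ?ltW.
have prod0 n : 0 <= \prod_(1 <= l < n.+1) (1 - Q ^- l) by apply: prodr_ge0.
apply: nonincreasing_is_cvgn; last by exists 0 => _ [n _ <-].
apply/nonincreasing_seqP => n; rewrite big_nat_recr //=.
by rewrite ler_piMr // gerBl invr_ge0 exprn_ge0 // ltW.
Qed.

Lemma mx_density_ge0 (R : realType) (F : finFieldType) n (Q : pred 'M[F]_n) :
  0 <= mx_density R Q.
Proof. by rewrite divr_ge0. Qed.

Lemma mx_density_le1 (R : realType) (F : finFieldType) n (Q : pred 'M[F]_n) :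
  mx_density R Q <= 1.
Proof.
rewrite ler_pdivrMr ?mul1r ?ler_nat ?max_card // ltr0n.
by apply/card_gt0P; exists 0.
Qed.

Section LimitDensity.
Variables (R : realType) (F : finFieldType) (r : nat).
Variables (P : 'I_r -> {poly F}) (H : 'I_r -> lmodType {poly F}).
Hypotheses (P_monic : forall j, P j \is monic)
  (P_irr : forall j, irreducible_poly (P j)) (P_inj : injective P).

Let q : R := #|F|%:R.

Let q_gt1 : 1 < q. Proof. by rewrite ltr1n card_finNzRing_gt1. Qed.

Let deg j := (size (P j)).-1.

Let deg_gt0 j : (0 < deg j)%N.
Proof. by rewrite /deg -subn1 subn_gt0 P_irr. Qed.

Let euler_limit j : R :=
  lim ((fun m : nat => \prod_(1 <= i < m.+1) (1 - q ^- (i * deg j))) @ \oo).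

Let cvg_euler_limit j :
  \prod_(1 <= l < n.+1) (1 - (q ^+ deg j) ^- l) @[n --> \oo] --> euler_limit j.
Proof.
rewrite /euler_limit (_ : (fun m => _) =
  fun n => \prod_(1 <= l < n.+1) (1 - (q ^+ deg j) ^- l)).
  by apply: cvg_euler_product; rewrite exprn_egt1 // -lt0n.
by apply/funext => n; apply: eq_bigr => i _; rewrite mulnC exprM.
Qed.

Lemma cvg_density_regular t : uniq t ->
  mx_density R (@has_local_type F r P H [::] t n) @[n --> \oo] -->
  \prod_(j <- t) euler_limit j.
Proof.
elim: t => [_|j t IHt /= /andP[jt /IHt {}IHt]].
  rewrite big_nil (_ : (fun n => _) = fun=> 1); first exact: cvg_cst.
  apply/funext => n; rewrite /mx_density (eq_card (B := predT)) // divff //.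
  by rewrite pnatr_eq0 -lt0n; apply/card_gt0P; exists 0.
rewrite big_cons; set L := \prod_(_ <- t) _ in IHt *.
set Q := q ^+ deg j.
have Q1 : 1 < Q by rewrite exprn_egt1 // -lt0n.
have Q2 : 2 <= Q.
  rewrite /Q /q -natrX ler_nat; apply: (leq_trans (card_finNzRing_gt1 F)).
  by rewrite -[X in (X <= _)%N]expn1 leq_pexp2l // ltnW // card_finNzRing_gt1.
set p := fun n => mx_density R (@has_local_type F r P H [::] t n) in IHt.
(* The error in replacing the [i]-th term by [L] times that of [euler_finite]; for fixed [i] it
   tends to [1 * L - L * 1 = 0]. *)
pose z n i := surj_density q n (i * deg j) * p (n - i * deg j)%N - L * surj_density Q n i.
have -> : (fun n => mx_density R (@has_local_type F r P H [::] (j :: t) n)) =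
    fun n => \sum_(i < n.+1) euler_coef Q i * z n i +
             L * \prod_(1 <= l < n.+1) (1 - Q ^- l).
  apply/funext => n; rewrite (density_regular_step R H P_monic P_irr P_inj) //.
  rewrite -(euler_finite _ Q1) mulr_sumr -big_split /=; apply: eq_bigr => i _.
  by rewrite -/q -/(deg j) -/Q -/(p _) /z; ring.
rewrite -[X in _ --> X]add0r; apply: cvgD; last first.
  by rewrite mulrC; apply: cvgM; [exact: cvg_cst | exact: cvg_euler_limit].
apply: (@tannery R _ _ 2 (1 + `|L|)) => [i|n i|i]; first exact: euler_coef_le.
  apply: le_trans (ler_normB _ _) _; apply: lerD; rewrite normrM.
    rewrite !ger0_norm ?surj_density_ge0 ?mx_density_ge0 //.
    by rewrite mulr_ile1 ?surj_density_ge0 ?surj_density_le1 ?mx_density_ge0 ?mx_density_le1.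
  by rewrite ler_piMr // ger0_norm ?surj_density_ge0 ?surj_density_le1.
rewrite -(subrr (1 * L)); apply: cvgB.
  apply: cvgM; first exact: cvg_surj_density.
  by have := IHt; rewrite -(cvg_centern (i * deg j)).
by rewrite mulrC; apply: cvgM; [exact: cvg_cst | exact: cvg_surj_density].
Qed.

Hypotheses (H_torsion : forall j, is_torsion (H j) (P j))
  (H_length : forall j, finite_length (H j)).

(** Each step moves one index from [s] to [t] at the cost of [1 / |Aut H_j|]; [surj_density] tends
    to 1 and the shift by [h] does not affect the limit. *)
Lemma cvg_density_local_type s t : uniq (s ++ t) ->
  mx_density R (@has_local_type F r P H s t n) @[n --> \oo] -->
  \prod_(j <- s) (card_aut (H j))%:R^-1 * \prod_(j <- s ++ t) euler_limit j.
Proof.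
elim: s t => [|j s IHs] t; first by rewrite big_nil mul1r; exact: cvg_density_regular.
move=> /= /andP[jst uniq_st].
have [h [T isoT]] := torsion_finite_length_matrix
  (irredp_neq0 (P_irr j)) (@H_torsion j) (H_length j).
have perm_st : perm_eq (s ++ j :: t) (j :: s ++ t) by rewrite -cat1s perm_catCA.
have /IHs cvg_s : uniq (s ++ j :: t) by rewrite (perm_uniq perm_st) /= jst.
rewrite -(perm_big _ perm_st) /= [X in X * _]big_cons -mulrA.
have -> : (fun n => mx_density R (@has_local_type F r P H (j :: s) t n)) = fun n =>
    (card_aut (H j))%:R^-1 * (surj_density q n h *
      mx_density R (@has_local_type F r P H s (j :: t) (n - h))).
  apply/funext => n.
  exact: (density_torsion_step R P_monic P_irr P_inj _ (@H_torsion j) isoT jst).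
apply: cvgM; first exact: cvg_cst.
rewrite -[X in _ --> X]mul1r; apply: cvgM; first exact: cvg_surj_density.
by have := cvg_s; rewrite -(cvg_centern h).
Qed.

End LimitDensity.

Unset Implicit Arguments.
Set Strict Implicit.
Set Printing Implicit Defensive.

Theorem theorem2p10 (R : realType) (F : finFieldType) (r : nat)
    (P : 'I_r -> {poly F}) (H : 'I_r -> lmodType {poly F})
    (P_monic : forall j, P j \is monic)
    (P_irr : forall j, irreducible_poly (P j))
    (P_inj : injective P)
    (H_torsion : forall j, is_torsion (H j) (P j))
    (H_length : forall j, finite_length (H j)) :
  (fun n : nat =>
     mx_prob R (fun A : 'M[F]_n =>
       forall j, mod_iso (torsion_part (mx_module A) (P j)) (H j)))
    @ \oo -->
  (\prod_(j < r)
     ((card_aut (H j))%:R^-1 *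
      lim ((fun m : nat =>
              \prod_(1 <= i < m.+1)
                 (1 - (#|F|%:R : R) ^- (i * (size (P j)).-1))) @ \oo)) : R).
Proof.
rewrite big_split /= -!big_enum /=.
rewrite -[X in _ * \prod_(_ <- X) _]cats0 (_ : (fun n => _) =
  fun n => mx_density R (@has_local_type F r P H (enum 'I_r) [::] n)).
  by apply: cvg_density_local_type => //; rewrite cats0 enum_uniq.
apply/funext => n; rewrite /mx_prob /mx_density cardsE; congr (_%:R / _).
apply: eq_card => A; rewrite -[LHS]topredE -[RHS]topredE /= /has_local_type andbT.
apply/asboolP/allP => [all_j j _|all_j j]; first exact/asboolP.
by apply/asboolP/all_j; rewrite mem_enum.
Qed.
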